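(* In the setting described in the context (kernels $\mu,\nu$, spaces $\mathcal{H}^0=X^0\times\mathcal{M}^0$ and $\mathcal{V}^0=X^0\times\mathcal{S}^0$, semigroups $S(t):\mathcal{H}^0\to\mathcal{H}^0$ and $\hat S(t):\mathcal{V}^0\to\mathcal{V}^0$, and map $\boldsymbol{\Lambda}:\mathcal{H}^0\to\mathcal{V}^0$), suppose that the following condition holds: for some $Q\in\mathfrak{I}$, for every $r\ge0$ and any initial datum $\hat{\boldsymbol{z}}\in\mathbb{B}_{\mathcal{V}^0}(r)$, setting $\boldsymbol{x}(t)=\Pi_1\hat S(t)\hat{\boldsymbol{z}}$ and $$\boldsymbol{\psi}^t(s)=\int_0^{\min\{t,s\}}\boldsymbol{A}\boldsymbol{x}(t-y)\,dy,$$ the function $\boldsymbol{Z}(t)=(\boldsymbol{x}(t),\boldsymbol{\psi}^t)$ belongs to $\mathcal{H}^0$ for every $t\ge0$ and $$\sup_{t\ge0}\|\boldsymbol{Z}(t)\|_{\mathcal{H}^0}\le Q(r).$$ If the semigroup $S(t):\mathcal{H}^0\to\mathcal{H}^0$ possesses an exponential attractor $\mathfrak{E}$, then the set $\hat{\mathfrak{E}}=\boldsymbol{\Lambda}\mathfrak{E}$ is an exponential attractor for the semigroup $\hat S(t):\mathcal{V}^0\to\mathcal{V}^0$.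
   Context: Notation. $\mathfrak{I}$ is the set of nondecreasing functions $Q:[0,\infty)\to[0,\infty)$. For a Banach space $\mathcal{H}$, $\mathbb{B}_{\mathcal{H}}(r)=\{z\in\mathcal{H}:\|z\|_{\mathcal{H}}\le r\}$. Kernels. $\mu\in L^1(\mathbb{R}^+)$, $\mathbb{R}^+=(0,\infty)$, is nonincreasing (hence nonnegative), piecewise absolutely continuous, right-continuous, possibly unbounded about zero; its discontinuity points, if any, form an increasing sequence $s_n$ that is either finite or tends to $\infty$, with jump amplitudes $\mu_n=\mu(s_n^-)-\mu(s_n)>0$. For some $\Theta\ge1$, $\delta>0$, $\mu(t+s)\le\Theta e^{-\delta t}\mu(s)$ for all $t,s>0$. Moreover $k(s)=\int_s^\infty\mu(y)\,dy$ satisfies $\int_0^\infty k(s)\,ds=1$. Set $\nu(\tau)=1/\mu(\tau)$, with $\nu(\tau)=0$ whenever $\mu(\tau)=0$; then $\nu(\tau-s)\le\Theta e^{-\delta s}\nu(\tau)$ for $s<\tau$ whenever $\nu(\tau)>0$. Spaces. $X^0,X^1,Y^0,Y^1$ are reflexive (real) Banach spaces with dense and compact embeddings $X^1\Subset X^0$, $Y^1\Subset Y^0$. $\mathcal{M}^0=L^2_\mu(\mathbb{R}^+;Y^0)$ with $\|\boldsymbol{\eta}\|^2_{\mathcal{M}^0}=\int_0^\infty\mu(s)\|\boldsymbol{\eta}(s)\|^2_{Y^0}ds$; $\mathcal{S}^0=L^2_\nu(\mathbb{R}^+;Y^0)$ with $\|\boldsymbol{\xi}\|^2_{\mathcal{S}^0}=\int_0^\infty\nu(\tau)\|\boldsymbol{\xi}(\tau)\|^2_{Y^0}d\tau$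 (elements of $\mathcal{S}^0$ being understood as vanishing where $\mu=0$); $\mathcal{H}^0=X^0\times\mathcal{M}^0$ and $\mathcal{V}^0=X^0\times\mathcal{S}^0$ with the norms $\|(\boldsymbol{x},\boldsymbol{\eta})\|^2_{\mathcal{H}^0}=\|\boldsymbol{x}\|^2_{X^0}+\|\boldsymbol{\eta}\|^2_{\mathcal{M}^0}$, $\|(\boldsymbol{x},\boldsymbol{\xi})\|^2_{\mathcal{V}^0}=\|\boldsymbol{x}\|^2_{X^0}+\|\boldsymbol{\xi}\|^2_{\mathcal{S}^0}$. $\Pi_1,\Pi_2$ denote the projections onto the first and second component. $T\boldsymbol{\eta}=-\boldsymbol{\eta}'$ with domain $\{\boldsymbol{\eta}\in\mathcal{M}^0:\boldsymbol{\eta}'\in\mathcal{M}^0,\boldsymbol{\eta}(0)=0\}$ generates the right-translation semigroup $R(t)$ on $\mathcal{M}^0$ ($(R(t)\boldsymbol{\eta})(s)=0$ for $s\le t$, $\boldsymbol{\eta}(s-t)$ for $s>t$); $P\boldsymbol{\xi}=\boldsymbol{\xi}'$ with domain $\{\boldsymbol{\xi}\in\mathcal{S}^0:\boldsymbol{\xi}'\in\mathcal{S}^0\}$ generates the left-translation semigroup on $\mathcal{S}^0$. Semigroups. $\boldsymbol{A},\boldsymbol{B}$ are (possibly nonlinear) densely defined operators. It is assumed that, in some weak sense, the systems $$\partial_t\boldsymbol{x}+\int_0^\infty\mu(s)\boldsymbol{\eta}^t(s)\,ds+\boldsymbol{B}\boldsymbol{x}=0,\quad \partial_t\boldsymbol{\eta}^t=T\boldsymbol{\eta}^t+\boldsymbol{A}\boldsymbol{x}(t)$$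 and $$\partial_t\boldsymbol{x}+\int_0^\infty\boldsymbol{\xi}^t(\tau)\,d\tau+\boldsymbol{B}\boldsymbol{x}=0,\quad \partial_t\boldsymbol{\xi}^t=P\boldsymbol{\xi}^t+\mu\boldsymbol{A}\boldsymbol{x}(t)$$ have unique global solutions for all initial data in $\mathcal{H}^0$ and $\mathcal{V}^0$ respectively, generating semigroups $S(t):\mathcal{H}^0\to\mathcal{H}^0$ and $\hat S(t):\mathcal{V}^0\to\mathcal{V}^0$, with second components given by $$\boldsymbol{\eta}^t(s)=(R(t)\boldsymbol{\eta}_0)(s)+\int_0^{\min\{t,s\}}\boldsymbol{A}\boldsymbol{x}(t-y)\,dy,\qquad \boldsymbol{\xi}^t(\tau)=\boldsymbol{\xi}_0(t+\tau)+\int_0^t\mu(\tau+s)\boldsymbol{A}\boldsymbol{x}(t-s)\,ds.$$ Moreover there exist $Q\in\mathfrak{I}$ and $\kappa=\kappa(r)\in(0,1]$ such that for all $t\ge0$: $\|S(t)\boldsymbol{z}_1-S(t)\boldsymbol{z}_2\|_{\mathcal{H}^0}\le Q(r)e^{Q(r)t}\|\boldsymbol{z}_1-\boldsymbol{z}_2\|_{\mathcal{H}^0}^\kappa$ for $\boldsymbol{z}_1,\boldsymbol{z}_2\in\mathbb{B}_{\mathcal{H}^0}(r)$, and $\|\hat S(t)\hat{\boldsymbol{z}}_1-\hat S(t)\hat{\boldsymbol{z}}_2\|_{\mathcal{V}^0}\le Q(r)e^{Q(r)t}\|\hat{\boldsymbol{z}}_1-\hat{\boldsymbol{z}}_2\|_{\mathcal{V}^0}^\kappa$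 for $\hat{\boldsymbol{z}}_1,\hat{\boldsymbol{z}}_2\in\mathbb{B}_{\mathcal{V}^0}(r)$. The map $\boldsymbol{\Lambda}$. For $\boldsymbol{\eta}\in\mathcal{M}^0$, $(\Lambda\boldsymbol{\eta})(\tau)=-\int_0^\infty\mu'(\tau+s)\boldsymbol{\eta}(s)\,ds+\sum_{\tau<s_n}\mu_n\boldsymbol{\eta}(s_n-\tau)$, and $\boldsymbol{\Lambda}(\boldsymbol{x},\boldsymbol{\eta})=(\boldsymbol{x},\Lambda\boldsymbol{\eta})$. Known facts taken as part of the setting: $\boldsymbol{\Lambda}$ is a bounded linear operator of unit norm from $\mathcal{H}^0$ into $\mathcal{V}^0$; $\int_0^\infty\mu(\tau+s)\boldsymbol{\eta}(s)\,ds=\int_\tau^\infty(\Lambda\boldsymbol{\eta})(y)\,dy=(\Lambda\boldsymbol{H})(\tau)$ with $\boldsymbol{H}(s)=\int_0^s\boldsymbol{\eta}(y)\,dy$, for all $\boldsymbol{\eta}\in\mathcal{M}^0$, $\tau>0$; and $\hat S(t)\boldsymbol{\Lambda}\boldsymbol{z}=\boldsymbol{\Lambda}S(t)\boldsymbol{z}$ for all $\boldsymbol{z}\in\mathcal{H}^0$, $t\ge0$. Exponential attractor. $\mathrm{dist}_{\mathcal{H}}(\mathcal{B}_1,\mathcal{B}_2)=\sup_{b_1\in\mathcal{B}_1}\inf_{b_2\in\mathcal{B}_2}\|b_1-b_2\|_{\mathcal{H}}$. An exponential attractor for a semigroup $S(t)$ on a Banach space $\mathcal{H}$ is a compact set $\mathfrak{E}\subset\mathcal{H}$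 such that $S(t)\mathfrak{E}\subset\mathfrak{E}$ for all $t\ge0$; $\mathfrak{E}$ has finite fractal dimension $\limsup_{r\to0}\ln N(r)/\ln(1/r)$ in $\mathcal{H}$ ($N(r)$ the smallest number of $r$-balls of $\mathcal{H}$ covering $\mathfrak{E}$); and there are $\omega>0$ and a nondecreasing positive function $Q$ with $\mathrm{dist}_{\mathcal{H}}(S(t)\mathcal{B},\mathfrak{E})\le Q(\|\mathcal{B}\|_{\mathcal{H}})e^{-\omega t}$ for all $t\ge0$ and every bounded $\mathcal{B}\subset\mathcal{H}$, where $\|\mathcal{B}\|_{\mathcal{H}}=\sup_{b\in\mathcal{B}}\|b\|_{\mathcal{H}}$. *)

(* Defs.v *)
From HB Require Import structures.
From mathcomp Require Import all_boot all_order all_algebra.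
From mathcomp Require Import all_classical all_reals all_analysis.
From mathcomp Require Import measurable_realfun ring.

Set Implicit Arguments.
Unset Strict Implicit.
Unset Printing Implicit Defensive.

Import Order.TTheory GRing.Theory Num.Theory.
Import numFieldNormedType.Exports.

Local Open Scope classical_set_scope.
Local Open Scope ring_scope.

Definition Rpos {R : realType} : set R := `]0, +oo[%classic.

Fact measurable_Rpos (R : realType) : measurable (@Rpos R).
Proof. exact: measurable_itv. Qed.
#[global] Hint Resolve measurable_Rpos : core.

Fact RposE (R : realType) (s : R) : Rpos s = (0 < s)%R.
Proof. by rewrite /Rpos/= in_itv/= andbT. Qed.

Notation leb := (@lebesgue_measure _).

Record seminorm (R : realType) (V : lmodType R) := Seminorm {
  seminorm_fun :> V -> R ;
  seminorm_triangle : forall x y : V,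
    seminorm_fun (x + y) <= seminorm_fun x + seminorm_fun y ;
  seminorm_homogeneous : forall (a : R) (x : V),
    seminorm_fun (a *: x) = `|a| * seminorm_fun x }.

Section SeminormQuotient.
Context (R : realType) (V : lmodType R) (p : seminorm V).

Fact seminorm_0 : p 0 = 0.
Proof. by rewrite -(scale0r (0 : V)) seminorm_homogeneous normr0 mul0r. Qed.

Fact seminorm_N x : p (- x) = p x.
Proof. by rewrite -scaleN1r seminorm_homogeneous normrN1 mul1r. Qed.

Fact seminorm_ge0 x : 0 <= p x.
Proof.
have := seminorm_triangle p x (- x); rewrite subrr seminorm_0 seminorm_N.
by rewrite -mulr2n pmulrn_lge0.
Qed.

Definition seminorm_equiv (x y : V) := p (x - y) == 0.

Fact seminorm_equiv_refl : reflexive seminorm_equiv.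
Proof. by move=> x; rewrite /seminorm_equiv subrr seminorm_0. Qed.

Fact seminorm_equiv_sym : symmetric seminorm_equiv.
Proof. by move=> x y; rewrite /seminorm_equiv -opprB seminorm_N. Qed.

Fact seminorm_equiv_trans : transitive seminorm_equiv.
Proof.
move=> y x z /eqP xy /eqP yz; rewrite /seminorm_equiv eq_le seminorm_ge0 andbT.
by rewrite -(subrKA y) (le_trans (seminorm_triangle _ _ _))// xy yz addr0.
Qed.

Canonical seminorm_equiv_rel :=
  EquivRel seminorm_equiv
    seminorm_equiv_refl seminorm_equiv_sym seminorm_equiv_trans.

Definition seminorm_quotient : Type := {eq_quot seminorm_equiv}%qT.

HB.instance Definition _ := Choice.on seminorm_quotient.
HB.instance Definition _ := EqQuotient.on seminorm_quotient.

Local Notation Q := seminorm_quotient.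
Local Notation cls x := (\pi_(seminorm_quotient)%qT x).

Fact seminorm_clsP (x y : V) : p (x - y) = 0 -> cls x = cls y.
Proof. by move=> xy; apply/eqmodP; rewrite /= /seminorm_equiv xy. Qed.

Fact seminorm_reprP (x : V) : p (repr (cls x) - x) = 0.
Proof. by apply/eqP; have /eqmodP := reprK (cls x). Qed.

Fact seminorm_eq0D (x y : V) : p x = 0 -> p y = 0 -> p (x + y) = 0.
Proof.
move=> x0 y0; apply/eqP; rewrite eq_le seminorm_ge0 andbT.
by rewrite (le_trans (seminorm_triangle _ _ _))// x0 y0 addr0.
Qed.

Fact seminorm_eq0Z a (x : V) : p x = 0 -> p (a *: x) = 0.
Proof. by move=> x0; rewrite seminorm_homogeneous x0 mulr0. Qed.

Definition seminorm_qadd (x y : Q) : Q := cls (repr x + repr y).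
Definition seminorm_qopp (x : Q) : Q := cls (- repr x).
Definition seminorm_qscale (a : R) (x : Q) : Q := cls (a *: repr x).

Fact seminorm_qaddE (x y : V) : seminorm_qadd (cls x) (cls y) = cls (x + y).
Proof.
by apply: seminorm_clsP; rewrite opprD addrACA seminorm_eq0D// seminorm_reprP.
Qed.

Fact seminorm_qscaleE a (x : V) : seminorm_qscale a (cls x) = cls (a *: x).
Proof.
by apply: seminorm_clsP; rewrite -scalerBr seminorm_eq0Z// seminorm_reprP.
Qed.

Fact seminorm_qoppE (x : V) : seminorm_qopp (cls x) = cls (- x).
Proof. by apply: seminorm_clsP; rewrite -opprD seminorm_N seminorm_reprP. Qed.

Fact seminorm_qind (P : Q -> Prop) : (forall x, P (cls x)) -> forall x, P x.
Proof. by move=> h x; rewrite -[x]reprK; exact: h. Qed.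

Fact seminorm_qaddA : associative seminorm_qadd.
Proof. by do 3! elim/seminorm_qind => ?; rewrite !seminorm_qaddE addrA. Qed.

Fact seminorm_qaddC : commutative seminorm_qadd.
Proof. by do 2! elim/seminorm_qind => ?; rewrite !seminorm_qaddE addrC. Qed.

Fact seminorm_qadd0 : left_id (cls 0) seminorm_qadd.
Proof. by elim/seminorm_qind => ?; rewrite !seminorm_qaddE add0r. Qed.

Fact seminorm_qaddN : left_inverse (cls 0) seminorm_qopp seminorm_qadd.
Proof.
by elim/seminorm_qind => ?; rewrite seminorm_qoppE seminorm_qaddE addNr.
Qed.

HB.instance Definition _ := GRing.isZmodule.Build seminorm_quotient
  seminorm_qaddA seminorm_qaddC seminorm_qadd0 seminorm_qaddN.

Fact seminorm_qscaleA a b (x : Q) :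
  seminorm_qscale a (seminorm_qscale b x) = seminorm_qscale (a * b) x.
Proof. by elim/seminorm_qind: x => x; rewrite !seminorm_qscaleE scalerA. Qed.

Fact seminorm_qscale1 : left_id 1 seminorm_qscale.
Proof. by elim/seminorm_qind => x; rewrite seminorm_qscaleE scale1r. Qed.

Fact seminorm_clsD (x y : V) : (cls x : Q) + cls y = cls (x + y).
Proof. exact: seminorm_qaddE. Qed.

Fact seminorm_qscaleDr : right_distributive seminorm_qscale +%R.
Proof.
move=> a x y; elim/seminorm_qind: x => x; elim/seminorm_qind: y => y.
rewrite seminorm_clsD [LHS]seminorm_qscaleE (seminorm_qscaleE a x).
by rewrite (seminorm_qscaleE a y) seminorm_clsD scalerDr.
Qed.

Fact seminorm_qscaleDl (x : Q) :
  {morph seminorm_qscale^~ x : a b / a + b}.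
Proof.
move=> a b; elim/seminorm_qind: x => x.
rewrite (seminorm_qscaleE a x) (seminorm_qscaleE b x).
by rewrite seminorm_qscaleE seminorm_clsD scalerDl.
Qed.

HB.instance Definition _ := GRing.Zmodule_isLmodule.Build R seminorm_quotient
  seminorm_qscaleA seminorm_qscale1 seminorm_qscaleDr seminorm_qscaleDl.

Definition seminorm_qnorm (x : Q) : R := p (repr x).

Fact seminorm_qnormE (x : V) : seminorm_qnorm (cls x) = p x.
Proof.
apply/eqP; rewrite eq_le; apply/andP; split.
  rewrite /seminorm_qnorm -[X in p X](subrK x).
  by rewrite (le_trans (seminorm_triangle _ _ _))// seminorm_reprP add0r.
rewrite /seminorm_qnorm -[X in p X <= _](subrK (repr (cls x))).
rewrite (le_trans (seminorm_triangle _ _ _))//.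
by rewrite -opprB seminorm_N seminorm_reprP add0r.
Qed.

Fact seminorm_qnorm_triangle (x y : Q) :
  seminorm_qnorm (x + y) <= seminorm_qnorm x + seminorm_qnorm y.
Proof.
elim/seminorm_qind: x => x; elim/seminorm_qind: y => y.
by rewrite seminorm_clsD !seminorm_qnormE seminorm_triangle.
Qed.

Fact seminorm_qnormZ (a : R) (x : Q) :
  seminorm_qnorm (a *: x) = `|a| * seminorm_qnorm x.
Proof.
elim/seminorm_qind: x => x.
rewrite /GRing.scale/= seminorm_qscaleE !seminorm_qnormE.
exact: seminorm_homogeneous.
Qed.

Fact seminorm_qnorm_eq0 (x : Q) : seminorm_qnorm x = 0 -> x = 0.
Proof.
elim/seminorm_qind: x => x; rewrite seminorm_qnormE => x0.
by apply: seminorm_clsP; rewrite subr0.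
Qed.

HB.instance Definition _ := Lmodule_isNormed.Build R seminorm_quotient
  seminorm_qnorm_triangle seminorm_qnormZ seminorm_qnorm_eq0.

End SeminormQuotient.

Section Bochner.
Context (R : realType) (Y : normedModType R).

(* A list of pairs (A, y) stands for the simple function \sum \1_A *: y. *)
Definition simple_eval (s : seq (set R * Y)) (x : R) : Y :=
  \sum_(p <- s) (\1_(p.1) x : R) *: p.2.

Definition simple (s : seq (set R * Y)) : Prop :=
  forall p, p \in s -> measurable p.1 /\ (leb p.1 < +oo)%E.

Definition simple_integral (D : set R) (s : seq (set R * Y)) : Y :=
  \sum_(p <- s) fine (leb (D `&` p.1)) *: p.2.

Definition strongly_measurable (D : set R) (f : R -> Y) : Prop :=
  exists s_ : nat -> seq (set R * Y), (forall n, simple (s_ n)) /\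
    forall x, D x -> (fun n => simple_eval (s_ n) x) @ \oo --> f x.

(* [f] is Bochner integrable on [D], with integral [I]. *)
Definition bochner_integral (D : set R) (f : R -> Y) (I : Y) : Prop :=
  exists (g : R -> Y) (s_ : nat -> seq (set R * Y)),
  [/\ {ae leb, forall x, D x -> f x = g x},
      forall n, simple (s_ n),
      forall x, D x -> (fun n => simple_eval (s_ n) x) @ \oo --> g x,
      (fun n => \int[leb]_(x in D) (`|g x - simple_eval (s_ n) x|)%:E)%E
        @ \oo --> 0%E &
      (fun n => simple_integral D (s_ n)) @ \oo --> I].

Lemma simple_cat s t : simple s -> simple t -> simple (s ++ t).
Proof. by move=> hs ht p; rewrite mem_cat => /orP[/hs|/ht]. Qed.

Lemma simple_eval_cat s t x :
  simple_eval (s ++ t) x = simple_eval s x + simple_eval t x.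
Proof. by rewrite /simple_eval big_cat. Qed.

Definition simple_scale (a : R) (s : seq (set R * Y)) :=
  [seq (p.1, a *: p.2) | p <- s].

Lemma simple_scaleP a s : simple s -> simple (simple_scale a s).
Proof. by move=> hs _ /mapP[p /hs ? ->]. Qed.

Lemma simple_eval_scale a s x :
  simple_eval (simple_scale a s) x = a *: simple_eval s x.
Proof.
rewrite /simple_eval /simple_scale big_map scaler_sumr.
by apply: eq_bigr => p _; rewrite !scalerA mulrC.
Qed.

Lemma measurable_norm_simple s : simple s ->
  measurable_fun setT (fun x => `|simple_eval s x|).
Proof.
move=> hs; suff h c : measurable_fun setT (fun x => `|c + simple_eval s x|).
  rewrite (_ : (fun x => _) = (fun x => `|0 + simple_eval s x|)); first exact: h.
  by apply/funext => x; rewrite add0r.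
elim: s hs c => [|p s IHs] hs c.
  rewrite (_ : (fun x => _) = cst `|c|); first exact: measurable_cst.
  by apply/funext => x; rewrite /simple_eval big_nil addr0.
have hs' : simple s by move=> q qs; apply: hs; rewrite inE qs orbT.
have mp : measurable p.1 by apply: (hs p _).1; rewrite inE eqxx.
rewrite (_ : (fun x => _) = (fun x => if x \in p.1 then
    `|(c + p.2) + simple_eval s x| else `|c + simple_eval s x|)); last first.
  apply/funext => x; rewrite /simple_eval big_cons indicE.
  by case: ifPn => _; rewrite ?scale1r ?scale0r ?add0r ?addrA.
apply: measurable_fun_ifT; [|exact: IHs|exact: IHs].
apply: (measurable_fun_bool true) => /=.
by rewrite setTI preimage_mem_true.
Qed.

Lemma measurable_norm_strong D f : measurable D -> strongly_measurable D f ->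
  measurable_fun D (fun x => `|f x|).
Proof.
move=> mD [s_ [hs sf]].
apply: (@measurable_fun_cvg _ _ _ D (fun n x => `|simple_eval (s_ n) x|)).
  by move=> n; apply: measurable_funS (measurable_norm_simple (hs n)).
by move=> x Dx; apply: cvg_norm; exact: sf.
Qed.

Lemma strongly_measurable0 D : strongly_measurable D 0.
Proof.
exists (fun=> [::]); split=> // x _.
by under eq_fun do rewrite /simple_eval big_nil; exact: cvg_cst.
Qed.

Lemma strongly_measurable_lin D a f g : strongly_measurable D f ->
  strongly_measurable D g -> strongly_measurable D (a *: f + g).
Proof.
move=> [s [hs sf]] [t [ht tg]].
exists (fun n => simple_scale a (s n) ++ t n); split=> [n|x Dx].
  by apply: simple_cat; [exact/simple_scaleP|exact: ht].
under eq_fun do rewrite simple_eval_cat simple_eval_scale.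
by apply: cvgD; [apply: cvgZr; exact: sf|exact: tg].
Qed.

End Bochner.

Record weight (R : realType) := Weight {
  weight_fun :> R -> R ;
  weight_measurable : measurable_fun Rpos weight_fun ;
  weight_ge0 : forall s, 0 < s -> 0 <= weight_fun s }.

Section WeightedL2.
Context (R : realType) (w : weight R) (Y : normedModType R).

Definition L2_integral (f : R -> Y) : \bar R :=
  (\int[leb]_(s in Rpos) (w s * `|f s| ^+ 2)%:E)%E.

(* Strong measurability is required everywhere on (0, +oo) with Borel simple
   functions; every almost everywhere class has such a representative. *)
Definition L2_pred : {pred R -> Y} := mem
  [set f : R -> Y | strongly_measurable Rpos f /\ (L2_integral f < +oo)%E].

Definition L2_root (f : R -> Y) : R -> R :=
  (fun s => (w s) `^ 2^-1 * `|f s|) \_ Rpos.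

Fact L2_root_measurable f : strongly_measurable Rpos f ->
  measurable_fun setT (L2_root f).
Proof.
move=> mf; apply/(measurable_restrictT _ (@measurable_Rpos R)).
apply: measurable_funM.
  apply: (@measurableT_comp _ _ _ _ _ _ (@powR R ^~ 2^-1)) => //.
  exact: weight_measurable.
exact: measurable_norm_strong.
Qed.

Fact L2_root_pow_measurable (h : R -> R) : measurable_fun setT h ->
  measurable_fun setT (fun s => `|h s| `^ 2).
Proof.
move=> mh; apply: (@measurableT_comp _ _ _ _ _ _ (@powR R ^~ 2)) => //.
exact: measurableT_comp.
Qed.

Fact L2_root_ge0 f s : 0 <= L2_root f s.
Proof.
by rewrite /L2_root patchE; case: ifPn => // _; rewrite mulr_ge0// powR_ge0.
Qed.

Fact L2_root_triangle f g s : L2_root (f + g) s <= L2_root f s + L2_root g s.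
Proof.
rewrite /L2_root !patchE; case: ifPn => _; last by rewrite addr0.
by rewrite -mulrDr ler_wpM2l ?powR_ge0// ler_normD.
Qed.

Fact L2_rootE f :
  (\int[leb]_s (`|L2_root f s| `^ 2)%:E)%E = L2_integral f.
Proof.
rewrite /L2_integral [RHS]integral_mkcond; apply: eq_integral => s _.
rewrite /L2_root !patchE; case: ifPn => [|_]; last by rewrite normr0 powR0.
rewrite inE RposE => s0.
rewrite powR12_sqrt ?weight_ge0// ger0_norm ?mulr_ge0 ?sqrtr_ge0//.
rewrite powR_mulrn ?mulr_ge0 ?sqrtr_ge0//.
by rewrite exprMn sqr_sqrtr// weight_ge0.
Qed.

Fact L2_integral_ge0 f : (0 <= L2_integral f)%E.
Proof. by rewrite -L2_rootE integral_ge0// => s _; rewrite lee_fin powR_ge0. Qed.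

Fact L2_LnormE f : ('N[leb]_2 [EFin \o L2_root f] = L2_integral f `^ 2^-1)%E.
Proof.
rewrite unlock /Lnorm -L2_rootE; congr (_ `^ _)%E.
Qed.

Fact L2_Lnorm_lty f :
  ('N[leb]_2 [EFin \o L2_root f] < +oo)%E = (L2_integral f < +oo)%E.
Proof.
rewrite L2_LnormE; apply/idP/idP; last by move=> ?; rewrite poweR_lty.
by move=> /lty_poweRy; apply; rewrite invr_neq0.
Qed.

Fact L2_root_scale a f s : L2_root (a *: f) s = `|a| * L2_root f s.
Proof.
rewrite /L2_root !patchE; case: ifPn => _; last by rewrite mulr0.
by rewrite [(a *: f) s]/(a *: f s) normrZ mulrCA.
Qed.

Fact L2_integral_scale a f : L2_pred f ->
  L2_integral (a *: f) = ((a ^+ 2)%:E * L2_integral f)%E.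
Proof.
move=> /set_mem/= [mf _].
rewrite -!L2_rootE -ge0_integralZl//=.
- apply: eq_integral => s _; rewrite L2_root_scale -EFinM; congr EFin.
  rewrite normrM normr_id powRM// powR_mulrn//.
  by rewrite real_normK// num_real.
- apply/measurable_EFinP; apply: L2_root_pow_measurable.
  exact: L2_root_measurable.
- by rewrite lee_fin sqr_ge0.
Qed.

Fact L2_Lnorm_triangle (f g : R -> Y) :
  strongly_measurable Rpos f -> strongly_measurable Rpos g ->
  ('N[leb]_2 [EFin \o L2_root (f + g)%R] <=
   'N[leb]_2 [EFin \o L2_root f] + 'N[leb]_2 [EFin \o L2_root g])%E.
Proof.
move=> mf mg.
apply: (@le_trans _ _ ('N[leb]_2 [EFin \o (L2_root f \+ L2_root g)%R])%E); last first.
  by apply: minkowski_EFin; rewrite ?ler1n//; exact: L2_root_measurable.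
have mfg : strongly_measurable Rpos (f + g).
  by rewrite -[f]scale1r; exact: strongly_measurable_lin.
rewrite unlock /Lnorm; apply: gt0_ler_poweR; first by rewrite invr_ge0.
- by rewrite in_itv/= leey andbT integral_ge0// => s _; rewrite lee_fin powR_ge0.
- by rewrite in_itv/= leey andbT integral_ge0// => s _; rewrite lee_fin powR_ge0.
apply: ge0_le_integral => //=.
- apply/measurable_EFinP; apply: L2_root_pow_measurable.
  exact: L2_root_measurable.
- apply/measurable_EFinP; apply: L2_root_pow_measurable.
  by apply: measurable_funD; exact: L2_root_measurable.
- move=> s _; rewrite lee_fin ge0_ler_powR//.
  by rewrite !ger0_norm ?addr_ge0 ?L2_root_ge0 ?L2_root_triangle.
Qed.

Fact L2_submod_closed : submod_closed L2_pred.
Proof.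
split=> [|a f g].
  apply/mem_set; split; first exact: strongly_measurable0.
  rewrite /L2_integral (eq_integral (cst 0%E)) ?integral0// => s _.
  by rewrite normr0 expr0n mulr0.
move=> fP gP; have /set_mem/= [mf If] := fP; have /set_mem/= [mg Ig] := gP.
have m0 : strongly_measurable Rpos (0 : R -> Y) by exact: strongly_measurable0.
apply/mem_set; split; first exact: strongly_measurable_lin.
rewrite -L2_Lnorm_lty (le_lt_trans (L2_Lnorm_triangle _ _))//.
  by rewrite -[a *: f]addr0; exact: strongly_measurable_lin.
rewrite lte_add_pinfty ?L2_Lnorm_lty// L2_integral_scale//.
by rewrite lte_mul_pinfty ?lee_fin ?sqr_ge0.
Qed.

HB.instance Definition _ := GRing.isSubmodClosed.Build R (R -> Y) L2_pred
  L2_submod_closed.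

Record L2_fun : Type := L2Fun { L2_val :> R -> Y ; _ : L2_val \in L2_pred }.

HB.instance Definition _ := [isSub for L2_val].
HB.instance Definition _ := [Choice of L2_fun by <:].
HB.instance Definition _ := [SubChoice_isSubLmodule of L2_fun by <:].

Definition L2_norm (f : L2_fun) : R := Num.sqrt (fine (L2_integral f)).

Fact L2_valP (f : L2_fun) :
  strongly_measurable Rpos f /\ (L2_integral f < +oo)%E.
Proof. by case: f => f fP; exact: set_mem fP. Qed.

Fact L2_normE (f : L2_fun) : (L2_norm f)%:E = ('N[leb]_2 [EFin \o L2_root f])%E.
Proof.
rewrite L2_LnormE /L2_norm; have [_ If] := L2_valP f.
rewrite -[in RHS](@fineK _ (L2_integral f)) ?ge0_fin_numE ?L2_integral_ge0//.
by rewrite poweR_EFin powR12_sqrt// fine_ge0// L2_integral_ge0.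
Qed.

Fact L2_norm_triangle (f g : L2_fun) : L2_norm (f + g) <= L2_norm f + L2_norm g.
Proof.
rewrite -lee_fin EFinD !L2_normE; apply: L2_Lnorm_triangle.
  exact: (L2_valP f).1.
exact: (L2_valP g).1.
Qed.

Fact L2_norm_scale (a : R) (f : L2_fun) : L2_norm (a *: f) = `|a| * L2_norm f.
Proof.
have [_ If] := L2_valP f; rewrite /L2_norm.
have -> : L2_integral (a *: f) = ((a ^+ 2)%:E * L2_integral f)%E.
  by apply: L2_integral_scale; case: f {If}.
rewrite fineM//=; last by rewrite ge0_fin_numE ?L2_integral_ge0.
by rewrite sqrtrM ?sqr_ge0// sqrtr_sqr.
Qed.

Definition L2_seminorm : seminorm L2_fun :=
  Seminorm L2_norm_triangle L2_norm_scale.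

Definition L2 : normedModType R := seminorm_quotient L2_seminorm.

(* The representative of a class that vanishes where the weight does. *)
Definition L2_repr (f : L2) : R -> Y :=
  let g : L2_fun := repr (f : seminorm_quotient L2_seminorm) in
  fun s => if w s == 0 then 0 else g s.

Lemma norm_L2E (f : L2) :
  `|f| = Num.sqrt (fine (\int[leb]_(s in Rpos) (w s * `|L2_repr f s| ^+ 2)%:E)%E).
Proof.
congr (Num.sqrt (fine _)); apply: eq_integral => s _; congr EFin.
by rewrite /L2_repr; case: ifPn => // /eqP ->; rewrite !mul0r.
Qed.

End WeightedL2.

Section EuclideanProduct.
Context (R : realType) (X Y : normedModType R).

Definition eprod : Type := (X * Y)%type.

HB.instance Definition _ := GRing.Lmodule.copy eprod (X * Y)%type.

Definition eprod_norm (z : eprod) : R :=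
  Num.sqrt (`|z.1| ^+ 2 + `|z.2| ^+ 2).

Fact eprod_norm_triangle (z z' : eprod) :
  eprod_norm (z + z') <= eprod_norm z + eprod_norm z'.
Proof.
rewrite /eprod_norm /=.
set a := `|z.1|; set b := `|z.2|; set c := `|z'.1|; set d := `|z'.2|.
have [a0 b0 c0 d0] : [/\ 0 <= a, 0 <= b, 0 <= c & 0 <= d].
  by split; exact: normr_ge0.
apply: (@le_trans _ _ (Num.sqrt ((a + c) ^+ 2 + (b + d) ^+ 2))).
  by rewrite ler_wsqrtr// lerD// ler_sqr ?nnegrE ?addr_ge0 ?normr_ge0// ler_normD.
have ab0 : 0 <= a ^+ 2 + b ^+ 2 by rewrite addr_ge0// sqr_ge0.
have cd0 : 0 <= c ^+ 2 + d ^+ 2 by rewrite addr_ge0// sqr_ge0.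
rewrite -(@ler_sqr _ (Num.sqrt _)) ?nnegrE ?addr_ge0 ?sqrtr_ge0//.
rewrite sqr_sqrtr ?addr_ge0 ?sqr_ge0// [leRHS]sqrrD !sqr_sqrtr// -sqrtrM//.
have h : a * c + b * d <= Num.sqrt ((a ^+ 2 + b ^+ 2) * (c ^+ 2 + d ^+ 2)).
  rewrite -(ger0_norm (_ : 0 <= a * c + b * d)) ?addr_ge0 ?mulr_ge0//.
  rewrite -sqrtr_sqr ler_wsqrtr// -subr_ge0.
  rewrite (_ : _ - _ = (a * d - b * c) ^+ 2); first exact: sqr_ge0.
  by ring.
move: (Num.sqrt _) h => S h.
rewrite -subr_ge0 (_ : _ - _ = 2 * (S - (a * c + b * d))); last by ring.
by rewrite mulr_ge0// subr_ge0.
Qed.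

Fact eprod_norm_scale (a : R) (z : eprod) :
  eprod_norm (a *: z) = `|a| * eprod_norm z.
Proof.
rewrite /eprod_norm /= !normrZ !exprMn -mulrDr sqrtrM ?sqr_ge0//.
by rewrite sqrtr_sqr normr_id.
Qed.

Fact eprod_norm_eq0 (z : eprod) : eprod_norm z = 0 -> z = 0.
Proof.
case: z => x y /eqP; rewrite /eprod_norm/= sqrtr_eq0 => h.
have : `|x| ^+ 2 + `|y| ^+ 2 == 0 by rewrite eq_le h addr_ge0// sqr_ge0.
rewrite paddr_eq0 ?sqr_ge0// !expf_eq0/= !normr_eq0 => /andP[/eqP-> /eqP->].
by [].
Qed.

HB.instance Definition _ := Lmodule_isNormed.Build R eprod
  eprod_norm_triangle eprod_norm_scale eprod_norm_eq0.

Lemma norm_eprodE (z : eprod) : `|z| = Num.sqrt (`|z.1| ^+ 2 + `|z.2| ^+ 2).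
Proof. by []. Qed.

End EuclideanProduct.

Section Vocabulary.
Context (R : realType).

Definition nondecreasing_nonneg (Q : R -> R) : Prop :=
  (forall r, 0 <= r -> 0 <= Q r) /\
  (forall r r', 0 <= r -> r <= r' -> Q r <= Q r').

Definition continuous_functional (X : normedModType R) (f : X -> R^o) : Prop :=
  linear f /\ continuous f.

(* The canonical map of X into its bidual is onto: [Phi] ranges over the bounded
   linear functionals on the dual, only its values on the dual being used. *)
Definition reflexive_space (X : normedModType R) : Prop :=
  forall Phi : (X -> R^o) -> R,
    (forall (a : R) (f g : X -> R^o), continuous_functional f ->
       continuous_functional g -> Phi (a *: f + g) = a * Phi f + Phi g) ->
    (exists C : R, forall (f : X -> R^o) (M : R), continuous_functional f ->
       0 <= M -> (forall x, `|f x| <= M * `|x|) -> `|Phi f| <= C * M) ->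
    exists x : X, forall f : X -> R^o, continuous_functional f -> Phi f = f x.

Definition dense_compact_embedding (X1 X0 : normedModType R)
    (e : {linear X1 -> X0}) : Prop :=
  [/\ injective e, continuous e, dense (range e) &
      forall B : set X1, bounded_set B -> precompact (e @` B)].

Definition unit_norm (H V : normedModType R) (f : H -> V) : Prop :=
  (forall z, `|f z| <= `|z|) /\
  (forall C : R, (forall z, `|f z| <= C * `|z|) -> 1 <= C).

Definition absolutely_continuous_on (a b : R) (f : R -> R) : Prop :=
  forall e, 0 < e -> exists2 d, 0 < d &
    forall (n : nat) (u v : nat -> R),
      (forall i, (i < n)%N -> [/\ a <= u i, u i <= v i & v i <= b]) ->
      (forall i, (i.+1 < n)%N -> v i <= u i.+1) ->
      \sum_(i < n) (v i - u i) < d -> \sum_(i < n) `|f (v i) - f (u i)| < e.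

End Vocabulary.

Section Semigroups.
Context (R : realType) (H : normedModType R).

Definition semigroup (S : R -> H -> H) : Prop :=
  (forall z, S 0 z = z) /\
  (forall t s z, 0 <= t -> 0 <= s -> S (t + s) z = S t (S s z)).

Definition hoelder_semigroup (Q kappa : R -> R) (S : R -> H -> H) : Prop :=
  forall (r t : R) (z1 z2 : H), 0 <= r -> 0 <= t -> `|z1| <= r -> `|z2| <= r ->
    `|S t z1 - S t z2| <= Q r * expR (Q r * t) * `|z1 - z2| `^ kappa r.

(* For every initial datum z0, S(.)z0 is the unique global solution issuing from
   z0 among the trajectories of the class [adm], [sol] being the property of
   solving the system. Only times t >= 0 are relevant. *)
Definition solution_semigroup (adm sol : (R -> H) -> Prop)
    (S : R -> H -> H) : Prop :=
  semigroup S /\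
  forall z0 : H, [/\ adm (S ^~ z0), sol (S ^~ z0) &
    forall z : R -> H, adm z -> sol z -> z 0 = z0 ->
      forall t, 0 <= t -> z t = S t z0].

Definition hausdorff_semidist (B1 B2 : set H) : \bar R :=
  ereal_sup [set ereal_inf [set (`|b1 - b2|)%:E | b2 in B2] | b1 in B1].

Definition covering_number (E : set H) (r : R) : \bar R :=
  ereal_inf [set (n%:R)%:E | n in [set n : nat | exists c : 'I_n -> H,
    forall z, E z -> exists i, `|z - c i| <= r]].

Definition fractal_dim (E : set H) : \bar R :=
  limf_esup (fun r : R => lne (covering_number E r) * ((ln r^-1)^-1)%:E)%E 0^'+.

Definition set_norm (B : set H) : R := sup [set `|b| | b in B].

Definition exponential_attractor (S : R -> H -> H) (E : set H) : Prop :=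
  [/\ compact E,
      forall t, 0 <= t -> S t @` E `<=` E,
      (fractal_dim E < +oo)%E &
      exists (omega : R) (Q : R -> R), [/\ 0 < omega,
        forall r, 0 <= r -> 0 < Q r,
        forall r r', 0 <= r -> r <= r' -> Q r <= Q r' &
        forall (B : set H) (t : R), bounded_set B -> 0 <= t ->
          (hausdorff_semidist (S t @` B) E <=
            (Q (set_norm B) * expR (- omega * t))%:E)%E]].

End Semigroups.

Record memory_kernel (R : realType) := MemoryKernel {
  mu :> R -> R ;
  (* number of discontinuity points, [None] if there are infinitely many *)
  njumps : option nat ;
  jump_at : nat -> R ;
  is_jump := fun n : nat => if njumps is Some N then (n < N)%N else true ;
  jump_size := fun n : nat =>
    lim (mu x @[x --> (jump_at n)^'-]) - mu (jump_at n) ;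
  mu_ge0 : forall s, 0 < s -> 0 <= mu s ;
  mu_nonincreasing : forall s t, 0 < s -> s <= t -> mu t <= mu s ;
  mu_integrable : leb.-integrable Rpos (EFin \o mu) ;
  mu_right_continuous : forall s, 0 < s -> mu x @[x --> s^'+] --> mu s ;
  jump_at_gt0 : forall n, is_jump n -> 0 < jump_at n ;
  jump_at_increasing : forall m n, (m < n)%N -> is_jump n ->
    jump_at m < jump_at n ;
  jump_at_cvg : njumps = None -> jump_at @ \oo --> +oo ;
  jump_atP : forall s, 0 < s ->
    (~ {for s, continuous mu} <-> exists2 n, is_jump n & jump_at n = s) ;
  jump_size_gt0 : forall n, is_jump n -> 0 < jump_size n ;
  mu_absolutely_continuous : forall a b, 0 < a -> a < b ->
    (forall n, is_jump n -> ~ (a < jump_at n <= b)) ->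
    absolutely_continuous_on a b mu ;
  mu_decay : exists Theta delta : R, [/\ 1 <= Theta, 0 < delta &
    forall t s, 0 < t -> 0 < s ->
      mu (t + s) <= Theta * expR (- delta * t) * mu s] ;
  mu_normalized : (\int[leb]_(s in Rpos)
    \int[leb]_(y in `]s, +oo[) (mu y)%:E)%E = 1%E }.

Section KernelWeights.
Context (R : realType) (K : memory_kernel R).

Fact mu_measurable : measurable_fun Rpos K.
Proof. by apply/measurable_EFinP; exact: measurable_int (mu_integrable K). Qed.

Definition mu_weight : weight R := Weight mu_measurable (@mu_ge0 R K).

Definition nu (tau : R) : R := if K tau == 0 then 0 else (K tau)^-1.

Fact nu_measurable : measurable_fun Rpos nu.
Proof.
apply: (@eq_measurable_fun _ _ _ _ _ (fun s => K s `^ (-1))).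
  move=> s; rewrite inE RposE => s0; rewrite /nu; case: ifPn => [/eqP ->|_].
    by rewrite powR0// oppr_eq0 oner_eq0.
  by rewrite powR_inv1// mu_ge0.
apply: (@measurableT_comp _ _ _ _ _ _ (@powR R ^~ (-1))) => //.
exact: mu_measurable.
Qed.

Fact nu_ge0 s : 0 < s -> 0 <= nu s.
Proof. by move=> s0; rewrite /nu; case: ifPn => // _; rewrite invr_ge0 mu_ge0. Qed.

Definition nu_weight : weight R := Weight nu_measurable nu_ge0.

End KernelWeights.

Definition M0 (R : realType) (K : memory_kernel R) (Y : normedModType R) :
  normedModType R := L2 (mu_weight K) Y.

Definition S0 (R : realType) (K : memory_kernel R) (Y : normedModType R) :
  normedModType R := L2 (nu_weight K) Y.

Definition H0 (R : realType) (K : memory_kernel R) (X Y : normedModType R) :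
  normedModType R := eprod X (M0 K Y).

Definition V0 (R : realType) (K : memory_kernel R) (X Y : normedModType R) :
  normedModType R := eprod X (S0 K Y).

Section Memory.
Context (R : realType) (K : memory_kernel R) (X Y : normedModType R).

Definition hfun (eta : M0 K Y) : R -> Y := @L2_repr R (mu_weight K) Y eta.
Definition sfun (xi : S0 K Y) : R -> Y := @L2_repr R (nu_weight K) Y xi.

Definition hpair (x : X) (eta : M0 K Y) : H0 K X Y := (x, eta).
Definition vpair (x : X) (xi : S0 K Y) : V0 K X Y := (x, xi).
Definition hPi1 (z : H0 K X Y) : X := z.1.
Definition hPi2 (z : H0 K X Y) : M0 K Y := z.2.
Definition vPi1 (z : V0 K X Y) : X := z.1.
Definition vPi2 (z : V0 K X Y) : S0 K Y := z.2.

(* For almost every s > 0 with respect to mu(s) ds. *)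
Definition mu_ae (P : R -> Prop) : Prop :=
  {ae leb, forall s, 0 < s -> K s != 0 -> P s}.

Definition right_translation (t : R) (eta : R -> Y) (s : R) : Y :=
  if s <= t then 0 else eta (s - t).

(* I = - \int_0^oo mu'(tau + s) eta(s) ds
       + \sum_(tau < s_n) mu_n eta(s_n - tau) *)
Definition Lambda_formula (eta : R -> Y) (tau : R) (I : Y) : Prop :=
  exists I1 I2 : Y, [/\
    bochner_integral Rpos (fun s => derive1 K (tau + s) *: eta s) I1,
    (fun N => \sum_(0 <= n < N | is_jump K n && (tau < jump_at K n))
       jump_size K n *: eta (jump_at K n - tau)) @ \oo --> I2 &
    I = - I1 + I2].

Definition is_Lambda (L : M0 K Y -> S0 K Y) : Prop :=
  forall eta : M0 K Y, {ae leb, forall tau, 0 < tau ->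
    Lambda_formula (hfun eta) tau (sfun (L eta) tau)}.

Definition LambdaX (L : M0 K Y -> S0 K Y) (z : H0 K X Y) : V0 K X Y :=
  vpair (hPi1 z) (L (hPi2 z)).

(* \int_0^oo mu(tau + s) eta(s) ds = \int_tau^oo (Lambda eta)(y) dy
     = (Lambda H)(tau)   with   H(s) = \int_0^s eta(y) dy;
   H(s) is only meaningful where mu does not vanish. *)
Definition Lambda_identity (L : M0 K Y -> S0 K Y) : Prop :=
  forall (eta : M0 K Y) (tau : R), 0 < tau ->
    exists (I : Y) (H : R -> Y), [/\
      bochner_integral Rpos (fun s => K (tau + s) *: hfun eta s) I,
      bochner_integral `]tau, +oo[ (sfun (L eta)) I,
      forall s, 0 < s -> K s != 0 -> bochner_integral `]0, s[ (hfun eta) (H s) &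
      Lambda_formula H tau I].

(* The operators A and B are defined on subsets of X and take their values in a
    Banach space W into which both X and Y are embedded; the equations and the
    integrals of A x are understood in W. The first equation of each system is
    integrated in time, the second one is replaced by its Duhamel formula (T and
    P generate the right and left translation semigroups). *)
Section Systems.
Context (W : normedModType R) (iX : X -> W) (iY : Y -> W).
Context (DA DB : set X) (A B : X -> W).

(* psi^t(s) = \int_0^(min{t, s}) A x(t - y) dy, with value I in W *)
Definition past_integral (x : R -> X) (t s : R) (I : W) : Prop :=
  bochner_integral `]0, Num.min t s[ (fun y => A (x (t - y))) I.

Definition first_equation (x : R -> X) (m : R -> Y) : Prop :=
  {ae leb, forall t, 0 < t -> DA (x t) /\ DB (x t)} /\
  forall t, 0 <= t ->
    (exists I, bochner_integral `]0, t[ (A \o x) I) /\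
    bochner_integral `]0, t[ (fun y => iY (m y) + B (x y)) (iX (x 0) - iX (x t)).

Definition history_solution (z : R -> H0 K X Y) : Prop :=
  (exists m : R -> Y, (forall t, 0 <= t ->
      bochner_integral Rpos (fun s => K s *: hfun (hPi2 (z t)) s) (m t)) /\
    first_equation (hPi1 \o z) m) /\
  forall t, 0 <= t -> mu_ae (fun s => exists2 I : W,
    past_integral (hPi1 \o z) t s I &
    iY (hfun (hPi2 (z t)) s) =
      iY (right_translation t (hfun (hPi2 (z 0))) s) + I).

Definition state_solution (z : R -> V0 K X Y) : Prop :=
  (exists m : R -> Y, (forall t, 0 <= t ->
      bochner_integral Rpos (sfun (vPi2 (z t))) (m t)) /\
    first_equation (vPi1 \o z) m) /\
  forall t, 0 <= t -> {ae leb, forall tau, 0 < tau -> exists2 I : W,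
    bochner_integral `]0, t[
      (fun s => K (tau + s) *: A (vPi1 (z (t - s)))) I &
    iY (sfun (vPi2 (z t)) tau) = iY (sfun (vPi2 (z 0)) (t + tau)) + I}.

(* Z(t) = (x(t), psi^t) belongs to H^0 and has norm at most Q(r). *)
Definition reconstruction_bound (Shat : R -> V0 K X Y -> V0 K X Y)
    (Q : R -> R) : Prop :=
  forall (r : R) (z : V0 K X Y), 0 <= r -> `|z| <= r -> forall t, 0 <= t ->
    exists2 psi : M0 K Y,
      mu_ae (fun s => past_integral (fun t => vPi1 (Shat t z)) t s
                        (iY (hfun psi s))) &
      `|hpair (vPi1 (Shat t z)) psi| <= Q r.

End Systems.

End Memory.

(* Main.v *)
(* The semigroup Shat almost factors through S: if Z(t) = (x(t), psi^t) is rebuilt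
   from the trajectory Shat(t)z, then Shat(t)z - Lambda Z(t) = (0, xi_0(t + .)),
   which decays like exp(- delta t / 2) because nu(tau) <= Theta e^{- delta t}
   nu(t + tau). Since Z(t) is bounded, following Lambda Z on the last fraction of
   [0, t] by S and using the Hoelder continuity of Shat transfers the exponential
   attraction to Lambda E, at a rate depending on the initial radius; a bounded
   absorbing set then makes the rate uniform.

   The formula for the error needs Lambda psi^t = \int_0^t mu(. + s) A x(t - s) ds
   although A x only takes values in W. It is tested against bounded functionals
   of W. The scalar identity says that mu(tau + .) is the tail function of the
   measure - mu'(tau + s) ds + \sum mu_n delta_(s_n - tau); this is read off
   Lambda_identity applied to the functions 1_A y0 with y0 in Y^0, and Tonelli's
   theorem then gives the identity for every integrable scalar function. *)
Require Import Defs.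
From mathcomp Require Import all_boot all_order all_algebra.
From mathcomp Require Import all_classical all_reals all_analysis.
From mathcomp Require Import ring lra measurable_realfun.

Set Implicit Arguments.
Unset Strict Implicit.
Unset Printing Implicit Defensive.

Import Order.TTheory GRing.Theory Num.Theory.
Import numFieldNormedType.Exports.

Local Open Scope classical_set_scope.
Local Open Scope ring_scope.

Section LebesgueAlmostEverywhere.
Context (R : realType).
Implicit Types P Q : R -> Prop.

Lemma ae_mono P Q : (forall x, P x -> Q x) ->
  {ae leb, forall x, P x} -> {ae leb, forall x, Q x}.
Proof. by move=> PQ; apply: (@filterS _ _ (ae_filter_ringOfSetsType leb)). Qed.

Lemma ae_and P Q : {ae leb, forall x, P x} -> {ae leb, forall x, Q x} ->
  {ae leb, forall x, P x /\ Q x}.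
Proof. exact: (@filterI _ _ (ae_filter_ringOfSetsType leb)). Qed.

End LebesgueAlmostEverywhere.

(** * Exponential attraction *)

Section ExponentialAttraction.
Context (R : realType).

Definition attracts_at_rate (H : normedModType R) (S : R -> H -> H) (E : set H)
    (omega r C : R) : Prop :=
  forall t z, 0 <= t -> `|z| <= r ->
    exists2 b, E b & `|S t z - b| <= C * expR (- omega * t).

(** Attraction is applied to the whole ball of radius [r]. Adding 1 to the constant puts the bound
    strictly above the infimum, so some point of [E] satisfies it. *)
Lemma exponential_attractor_attracts (H : normedModType R) (S : R -> H -> H)
    (E : set H) : exponential_attractor S E ->
  exists2 omega, 0 < omega & forall r, exists2 C, 0 <= C &
    attracts_at_rate S E omega r C.
Proof.
move=> [_ _ _ [omega [Q [omega0 _ _ hQ]]]]; exists omega => // r.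
pose B : set H := [set z | `|z| <= r].
have bB : bounded_set B.
  exists r; split; first exact: num_real.
  by move=> M rM z /= Bz; exact: le_trans Bz (ltW rM).
exists (`|Q (set_norm B)| + 1); first by rewrite addr_ge0.
move=> t z t0 zr.
have := hQ B t bB t0; set q := Q _ => hq.
have lt1 : (ereal_inf [set (`|S t z - b2|)%:E | b2 in E] <
    ((`|q| + 1) * expR (- omega * t))%:E)%E.
  apply: (@le_lt_trans _ _ (q * expR (- omega * t))%:E); last first.
    rewrite lte_fin ltr_pM2r ?expR_gt0//.
    by rewrite (le_lt_trans (ler_norm _))// ltrDl.
  apply: le_trans hq; apply: ereal_sup_ubound => /=.
  by exists (S t z) => //; exists z.
have [_ [b Eb <-]] := ereal_inf_lt lt1.
by rewrite lte_fin => /ltW; exists b.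
Qed.

(** Only the rate must be uniform. The constants, chosen at integer radii without any monotonicity,
    are summed into a nondecreasing positive function. *)
Lemma attracts_hausdorff (H : normedModType R) (S : R -> H -> H) (E : set H)
    (omega : R) : 0 < omega ->
    (forall r, exists2 C, 0 <= C & attracts_at_rate S E omega r C) ->
  exists (omega : R) (Q : R -> R), [/\ 0 < omega,
    forall r, 0 <= r -> 0 < Q r,
    forall r r', 0 <= r -> r <= r' -> Q r <= Q r' &
    forall (B : set H) (t : R), bounded_set B -> 0 <= t ->
      (hausdorff_semidist (S t @` B) E <=
        (Q (set_norm B) * expR (- omega * t))%:E)%E].
Proof.
move=> omega0 /(_ _%:R)/cid2-/all_sig2[C C0 hC].
pose q n : R := 1 + \sum_(i < n) C i.
have qC n : C n <= q n.+1.
  by rewrite /q big_ord_recr/= addrA lerDr addr_ge0// sumr_ge0.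
have q_homo : {homo q : m n / (m <= n)%N >-> m <= n}.
  apply: homo_leq => [//|? ? ?|n]; first exact: le_trans.
  by rewrite /q big_ord_recr/= addrA lerDl.
(* With [n = (truncn r).+1] one has [r < n], so the ball of radius [n] contains [B]; the second
   successor comes from [C n <= q n.+1]. *)
exists omega, (fun r => q (Num.truncn r).+2); split => //.
- by move=> r _; rewrite (lt_le_trans ltr01)// /q lerDl sumr_ge0.
- by move=> r r' r0 rr'; apply: q_homo; rewrite !ltnS le_truncn.
- move=> B t [M [_ bB]] t0; apply: ge_ereal_sup => _ [_ [b Bb <-] <-].
  have bn : `|b| <= (Num.truncn (set_norm B)).+1%:R.
    rewrite (le_trans _ (ltW (truncnS_gt _)))//.
    apply: ub_le_sup; last by exists b.
    by exists (M + 1) => _ [z Bz <-]; apply: (bB (M + 1)) => //; rewrite ltrDl.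
  have [e Ee he] := hC _ _ _ t0 bn.
  apply: ge_ereal_inf; exists (`|S t b - e|)%:E; first by exists e.
  rewrite lee_fin (le_trans he)// ler_wpM2r ?expR_ge0//; exact: qC.
Qed.

End ExponentialAttraction.

(** * Transfer of an exponential attractor along a 1-Lipschitz intertwining map *)

Section AttractorTransfer.
Context (R : realType) (H V : normedModType R) (L : H -> V).
Hypothesis L_lip : forall z z', `|L z - L z'| <= `|z - z'|.

Lemma lipschitz1_image_compact (E : set H) : compact E -> compact (L @` E).
Proof.
apply: continuous_compact; apply: continuous_subspaceT => z.
apply/cvgrPdist_lt => e e0; near=> z'; apply: le_lt_trans (L_lip _ _) _.
by near: z'; exact: cvgr_dist_lt.
Unshelve. all: by end_near. Qed.

(** The images of the centers of a cover by [r]-balls are centers of such a cover of the image, so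
    covering numbers do not increase. *)
Lemma lipschitz1_image_fractal_dim (E : set H) :
  (fractal_dim (L @` E) <= fractal_dim E)%E.
Proof.
apply: le_ereal_inf_tmp => _ [U U0 <-].
(* For [r < 1] the factor [(ln r^-1)^-1] is nonnegative, so multiplying by it preserves the
   order. *)
have U1 : 0^'+ (U `&` [set r : R | 0 < r < 1]).
  apply: filterI; first exact: U0.
  by near=> r => /=; apply/andP; split.
apply: (@le_trans _ _ (ereal_sup [set (lne (covering_number (L @` E) r) *
    ((ln r^-1)^-1)%:E)%E | r in U `&` [set r : R | (0 < r) && (r < 1)]])).
  apply: ge_ereal_inf; eexists; last exact: lexx.
  by exists (U `&` [set r : R | (0 < r) && (r < 1)]).
apply: ge_ereal_sup => _ [r [Ur /andP[r0 r1]] <-].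
apply: le_trans (ereal_sup_ubound _); last by exists r.
have ge0 (T : normedModType R) (A : set T) : (0 <= covering_number A r)%E.
  by apply: le_ereal_inf_tmp => _ [n _ <-]; rewrite lee_fin.
apply: lee_wpmul2r.
  by rewrite lee_fin invr_ge0 ln_ge0// invf_ge1// ltW.
rewrite lee_lne ?in_itv/= ?leey ?ge0//.
apply: ereal_inf_le_tmp => _ [n [c hc] <-]; exists n => //.
exists (L \o c) => _ [z /hc[i hi] <-]; exists i; exact: le_trans (L_lip _ _) hi.
Unshelve. all: by end_near. Qed.

Variables (S : R -> H -> H) (Shat : R -> V -> V).
Hypothesis Shat_semigroup : semigroup Shat.
Hypothesis L0 : forall z, `|L z| <= `|z|.
Hypothesis intertwines : forall t z, 0 <= t -> Shat t (L z) = L (S t z).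
Variables (Q kappa : R -> R).
Hypothesis Q_ge0 : forall r, 0 <= r -> 0 <= Q r.
Hypothesis kappa01 : forall r, 0 <= r -> 0 < kappa r <= 1.
Hypothesis Shat_hoelder : hoelder_semigroup Q kappa Shat.
Variables (D d : R) (q : R -> R).
Hypotheses (D0 : 0 <= D) (d0 : 0 < d).
Hypothesis q_ge0 : forall r, 0 <= r -> 0 <= q r.
Hypothesis shadow : forall r t z, 0 <= r -> 0 <= t -> `|z| <= r ->
  exists2 Z, `|Z| <= q r & `|Shat t z - L Z| <= D * expR (- d * t) * r.

(* On the last fraction theta of [0, t] the shadow L Z follows L E at the rate
   of S; theta is small enough for the Hoelder constant of Shat not to destroy
   the gain obtained on [0, (1 - theta) t]. The rate depends on r. *)
Lemma attraction_local (E : set H) (omega : R) : 0 < omega ->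
    (forall r, exists2 C, 0 <= C & attracts_at_rate S E omega r C) ->
  forall r, 0 <= r -> exists omega' C : R, [/\ 0 < omega', 0 <= C &
    attracts_at_rate Shat (L @` E) omega' r C].
Proof.
move=> omega0 hE r r0.
have [C C0 hC] := hE (q r).
(* This radius contains both [L Z] and the trajectory that it shadows, as the Hoelder estimate
   requires. *)
pose r' := q r + D * r.
have r'0 : 0 <= r' by rewrite addr_ge0 ?mulr_ge0// q_ge0.
have /andP[k0 k1] := kappa01 r'0.
pose l := Q r' + 1; have l0 : 0 < l by rewrite ltr_wpDl ?Q_ge0.
(* The shadowing error raised to the power [kappa r'] decays like [expR (- (2 * a) * s)]. The choice
   of [theta] makes the growth [expR (l * u)] equal to [expR (a * s)], which uses up half of that
   decay. *)
pose a := kappa r' * d / 2; have a0 : 0 < a by rewrite divr_gt0 ?mulr_gt0.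
have la0 : 0 < l + a by rewrite addr_gt0.
pose theta := a / (l + a).
have th0 : 0 < theta by rewrite divr_gt0.
have th1 : 0 < 1 - theta.
  by rewrite subr_gt0 /theta ltr_pdivrMr// mul1r ltrDr.
have key : l * theta = a * (1 - theta).
  by rewrite /theta; field; rewrite gt_eqF.
pose c := (D * r) `^ kappa r'.
have c0 : 0 <= c by exact: powR_ge0.
exists (Num.min (omega * theta) (a * (1 - theta))), (l * c + C).
split.
- by rewrite lt_min; apply/andP; split; exact: mulr_gt0.
- by rewrite addr_ge0 ?mulr_ge0// ltW.
move=> t z t0 zr.
pose s := (1 - theta) * t; pose u := theta * t.
have s0 : 0 <= s by rewrite mulr_ge0// ltW.
have u0 : 0 <= u by rewrite mulr_ge0// ltW.
have tE : t = u + s by rewrite /s /u; ring.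
have [Z Zq hZ] := shadow r0 s0 zr.
have [e Ee he] := hC u Z u0 Zq.
exists (L e); first by exists e.
have e1 (x : R) : 0 <= x -> expR (- d * x) <= 1.
  by move=> x0; rewrite -expR0 ler_expR mulNr oppr_le0 mulr_ge0// ltW.
have LZ : `|L Z| <= r'.
  by rewrite (le_trans (L0 _))// (le_trans Zq)// lerDl mulr_ge0.
have Sz : `|Shat s z| <= r'.
  rewrite -[Shat s z](subrK (L Z)) (le_trans (ler_normD _ _))// [leLHS]addrC lerD//.
    exact: le_trans (L0 _) Zq.
  by rewrite (le_trans hZ)// mulrAC ler_piMr ?mulr_ge0// e1.
have := Shat_hoelder r'0 u0 Sz LZ.
rewrite intertwines// -(Shat_semigroup.2 _ _ _ u0 s0) -tE => h1.
rewrite -[_ - L e](subrKA (L (S u Z))) (le_trans (ler_normD _ _))// mulrDl lerD//.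
  apply: le_trans h1 _.
  apply: (@le_trans _ _ (l * expR (l * u) * (c * expR (- (2 * a) * s)))).
    apply: ler_pM; rewrite ?mulr_ge0 ?powR_ge0 ?expR_ge0 ?Q_ge0//.
      apply: ler_pM; rewrite ?expR_ge0 ?Q_ge0 ?lerDl//.
      by rewrite ler_expR ler_wpM2r// lerDl.
    apply: (@le_trans _ _ ((D * expR (- d * s) * r) `^ kappa r')).
      by rewrite ge0_ler_powR ?nnegrE ?mulr_ge0 ?expR_ge0 ?normr_ge0// ltW.
    rewrite mulrAC powRM ?mulr_ge0 ?expR_ge0// /c ler_wpM2l ?powR_ge0//.
    rewrite le_eqVlt; apply/orP; left; apply/eqP.
    rewrite /powR gt_eqF ?expR_gt0// expRK; congr expR.
    by rewrite /a; field.
  rewrite mulrACA -expRD ler_wpM2l ?mulr_ge0 ?(ltW l0)// ler_expR.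
  have -> : l * u + - (2 * a) * s = - (a * (1 - theta)) * t.
    by rewrite /u mulrA key /s; ring.
  by rewrite ler_wpM2r// lerN2 ge_min lexx orbT.
apply: le_trans (L_lip _ _) _; apply: le_trans he _.
rewrite ler_wpM2l// ler_expR /u mulrA ler_wpM2r// mulNr lerN2.
by rewrite ge_min lexx.
Qed.

Lemma attraction_uniform (E : set H) (omega : R) : 0 < omega -> compact E ->
    (forall r, exists2 C, 0 <= C & attracts_at_rate S E omega r C) ->
  exists2 omega', 0 < omega' & forall r, exists2 C, 0 <= C &
    attracts_at_rate Shat (L @` E) omega' r C.
Proof.
move=> omega0 cE hE; have local := attraction_local omega0 hE.
have [M [_ bE]] := compact_bounded cE.
pose M1 := `|M| + 1; have M10 : 0 <= M1 by rewrite addr_ge0.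
have LM z : E z -> `|L z| <= M1.
  move=> Ez; rewrite (le_trans (L0 z))//.
  by apply: (bE M1) => //; rewrite (le_lt_trans (ler_norm M))// ltrDl.
have [w [C1 [w0 C10 h1]]] := local (M1 + 1) (addr_ge0 M10 ler01).
exists w => // r.
have [r0|r0] := leP 0 r; last first.
  by exists 0 => // t z _ /(le_trans (normr_ge0 _)); rewrite leNgt r0.
have [w2 [C2 [w20 C20 h2]]] := local r r0.
(* At this time the local bound is [C2 * expR (- C2)], at most 1 because [C2 <= expR C2]. *)
pose T := C2 / w2; have T0 : 0 <= T by rewrite divr_ge0// ltW.
have T1 : C2 * expR (- w2 * T) <= 1.
  rewrite -(ler_pM2r (expR_gt0 C2)) mul1r -mulrA -expRD.
  rewrite (_ : - w2 * T + C2 = 0); last by rewrite /T; field; rewrite gt_eqF.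
  by rewrite expR0 mulr1 (le_trans _ (expR_ge1Dx C2))// lerDr.
have C12 : 0 <= C1 + C2 by rewrite addr_ge0.
exists ((C1 + C2) * expR (w * T)); first by rewrite mulr_ge0 ?expR_ge0.
move=> t z t0 zr; rewrite -mulrA -expRD.
have [tT|Tt] := leP t T.
  have [b Eb hb] := h2 t z t0 zr; exists b => //; rewrite (le_trans hb)//.
  apply: ler_pM; rewrite ?expR_ge0 ?lerDr// ler_expR mulNr.
  rewrite (@le_trans _ _ 0) ?oppr_le0 ?mulr_ge0 ?(ltW w20)//.
  by rewrite mulNr -mulrBr mulr_ge0 ?(ltW w0)// subr_ge0.
have [b [e Ee eb] hb] := h2 T z T0 zr.
have Sb : `|Shat T z| <= M1 + 1.
  rewrite -[Shat T z](subrK b) (le_trans (ler_normD _ _))// [leLHS]addrC lerD//.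
    by rewrite -eb LM.
  exact: le_trans hb T1.
have tT0 : 0 <= t - T by rewrite subr_ge0 ltW.
have [b' Eb' hb'] := h1 _ _ tT0 Sb; exists b' => //.
move: hb'; rewrite -(Shat_semigroup.2 _ _ _ tT0 T0) subrK => hb'.
rewrite (le_trans hb')//; apply: ler_pM; rewrite ?expR_ge0 ?lerDl//.
by rewrite ler_expR mulNr mulrBr opprB mulNr.
Qed.

Lemma exponential_attractor_transfer (E : set H) :
  exponential_attractor S E -> exponential_attractor Shat (L @` E).
Proof.
move=> ES; have [cE invE dE _] := ES; split.
- exact: lipschitz1_image_compact.
- move=> t t0 _ [_ [z Ez <-] <-]; exists (S t z); last by rewrite intertwines.
  by apply: (invE t t0); exists z.
- exact: le_lt_trans (lipschitz1_image_fractal_dim E) dE.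
- have [w w0 hE] := exponential_attractor_attracts ES.
  have [w' w'0 hE'] := attraction_uniform w0 cE hE.
  exact: attracts_hausdorff w'0 hE'.
Qed.

End AttractorTransfer.

(** * Bounded functionals and Bochner integrals *)

Section HahnBanach.
Context (R : realType) (V : normedModType R).
Implicit Types (p q : V -> R) (x y : V).

Definition sublinear p : Prop :=
  (forall x y, p (x + y) <= p x + p y) /\
  (forall a x, 0 < a -> p (a *: x) <= a * p x).

Lemma sublinearZ p : sublinear p -> forall a x, 0 < a -> p (a *: x) = a * p x.
Proof.
move=> [_ pZ] a x a0; apply/eqP; rewrite eq_le pZ//=.
rewrite -[x in leLHS](scalerK (lt0r_neq0 a0)) -ler_pdivlMl//.
by rewrite pZ// invr_gt0.
Qed.

Lemma sublinear0 p : sublinear p -> p 0 = 0.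
Proof.
move=> hp; have := sublinearZ hp 0 (ltr0Sn R 1); rewrite scaler0 => h; lra.
Qed.

Lemma sublinear_geN p x : sublinear p -> - p (- x) <= p x.
Proof.
move=> hp; have := hp.1 x (- x); rewrite subrr sublinear0// => h; lra.
Qed.

(** For sublinear [p] this is the largest sublinear functional below [p] whose value at [- y] is at
    most [- p y]. *)
Definition sublinear_tilt p y x : R :=
  inf [set p (x + t *: y) - t * p y | t in [set t | 0 <= t]].

Lemma sublinear_tilt_le p y x t : sublinear p -> 0 <= t ->
  sublinear_tilt p y x <= p (x + t *: y) - t * p y.
Proof.
move=> hp t0; apply: ge_inf; last by exists t.
exists (- p (- x)) => _ [s s0 <-].
have h := hp.1 (x + s *: y) (- x).
rewrite addrAC subrr add0r in h.
have : s * p y = p (s *: y).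
  move: s0; rewrite /= le_eqVlt => /predU1P[<-|s0]; last by rewrite sublinearZ.
  by rewrite scale0r mul0r sublinear0.
by move=> e; lra.
Qed.

Lemma sublinear_tilt_ge p y x c :
  (forall t, 0 <= t -> c <= p (x + t *: y) - t * p y) -> c <= sublinear_tilt p y x.
Proof.
move=> h; apply: lb_le_inf; last by move=> _ [t t0 <-]; exact: h.
by exists (p (x + 0 *: y) - 0 * p y), 0 => /=.
Qed.

Lemma sublinear_tiltP p y : sublinear p -> sublinear (sublinear_tilt p y).
Proof.
move=> hp; split=> [x1 x2|a x a0].
  rewrite -lerBlDl; apply: sublinear_tilt_ge => t2 t20.
  rewrite lerBlDl -lerBlDr; apply: sublinear_tilt_ge => t1 t10.
  have := sublinear_tilt_le y (x1 + x2) hp (addr_ge0 t10 t20).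
  have := hp.1 (x1 + t1 *: y) (x2 + t2 *: y).
  by rewrite addrACA -scalerDl; lra.
rewrite -ler_pdivrMl//; apply: sublinear_tilt_ge => t t0.
rewrite ler_pdivrMl// (le_trans (sublinear_tilt_le y (a *: x) hp (mulr_ge0 (ltW a0) t0)))//.
by rewrite -scalerA -scalerDr sublinearZ// mulrBr mulrA.
Qed.

(* The decreasing infimum of a chain is sublinear, so Zorn applies; a minimal
   sublinear [p] coincides with all its tilts, hence [p (- y) = - p y]. *)
Lemma minimal_sublinear p0 : sublinear p0 -> exists p,
  [/\ forall x, p x <= p0 x, forall x y, p (x + y) = p x + p y &
      forall a x, p (a *: x) = a * p x].
Proof.
move=> hp0.
pose T := {p | sublinear p /\ forall x, p x <= p0 x}.
(* The order is reversed, so that a maximal element in the sense of Zorn is a minimal functional. *)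
pose le_T (s t : T) := `[< forall x, sval t x <= sval s x >].
have lbT (s : T) x : - p0 (- x) <= sval s x.
  case: s => p /= [hp pp0]; have := sublinear_geN x hp; have := pp0 (- x); lra.
have [t|r s t /asboolP rs /asboolP st|s t /asboolP st /asboolP ts|F totF|] :=
    @Zorn T le_T.
- exact/asboolP.
- by apply/asboolP => x; exact: le_trans (rs x).
- case: s t st ts => [p hp] [q hq] /= st ts.
  have pq : p = q by apply/funext => x; apply/eqP; rewrite eq_le st ts.
  by case: _ / pq hq {st ts} => hq; congr exist; exact: Prop_irrelevance.
- have [[s0 Fs0]|F0] := pselect (F !=set0); last first.
    have hp00 : sublinear p0 /\ forall x, p0 x <= p0 x by [].
    by exists (exist _ p0 hp00) => s Fs; case: F0; exists s.
  pose p x := inf [set sval s x | s in F].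
  have p_le s x : F s -> p x <= sval s x.
    move=> Fs; apply: ge_inf; last by exists s.
    by exists (- p0 (- x)) => _ [u _ <-].
  have p_ge c x : (forall s, F s -> c <= sval s x) -> c <= p x.
    move=> h; apply: lb_le_inf; last by move=> _ [s Fs <-]; exact: h.
    by exists (sval s0 x), s0.
  have hp : sublinear p /\ forall x, p x <= p0 x.
    split; last by move=> x; rewrite (le_trans (p_le _ _ Fs0))// (svalP s0).2.
    split=> [x y|a x a0].
      rewrite -lerBlDl; apply: (p_ge) => s Fs.
      rewrite lerBlDl -lerBlDr; apply: (p_ge) => u Fu; rewrite lerBlDr.
      (* Subadditivity is applied to the smaller of the two members of the chain. *)
      have [/asboolP us|/asboolP su] := totF _ _ Fu Fs.
        rewrite (le_trans (p_le _ _ Fs))// (le_trans ((svalP s).1.1 _ _))//.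
        by rewrite lerD2r.
      rewrite (le_trans (p_le _ _ Fu))// (le_trans ((svalP u).1.1 _ _))//.
      by rewrite lerD2l.
    rewrite -ler_pdivrMl//; apply: (p_ge) => s Fs; rewrite ler_pdivrMl//.
    by rewrite (le_trans (p_le _ _ Fs))// (svalP s).1.2.
  by exists (exist _ p hp) => s Fs; apply/asboolP => x; exact: p_le.
move=> [p [hp pp0]] minp; exists p.
have pN y : p (- y) = - p y.
  have tilt_le x : sublinear_tilt p y x <= p x.
    have := sublinear_tilt_le y x hp (lexx 0).
    by rewrite scale0r addr0 mul0r subr0.
  have ht : sublinear (sublinear_tilt p y) /\ forall x, sublinear_tilt p y x <= p0 x.
    by split=> [|x]; [exact: sublinear_tiltP|exact: le_trans (pp0 x)].
  have /(congr1 sval)/= e : exist _ _ ht = exist _ p (conj hp pp0) :> T.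
    by apply: minp; exact/asboolP.
  have := sublinear_tilt_le y (- y) hp ler01; rewrite e.
  rewrite scale1r addNr sublinear0// mul1r sub0r => h.
  have := sublinear_geN (- y) hp; rewrite opprK => h'.
  by apply/eqP; rewrite eq_le h h'.
have pD x y : p (x + y) = p x + p y.
  apply/eqP; rewrite eq_le hp.1/= -lerBrDr -pN.
  by rewrite -[x in p x <= _](addrK y) hp.1.
split => // a x.
have [a0|a0|<-] := ltgtP 0 a; last by rewrite scale0r mul0r sublinear0.
  exact: sublinearZ.
have Na0 : 0 < - a by rewrite oppr_gt0.
by apply: oppr_inj; rewrite -pN -scaleNr sublinearZ// mulNr.
Qed.

(** A linear functional below the norm tilted along [v] satisfies [phi (- v) <= - |v|], hence does
    not vanish at [v], and it stays below the norm itself. *)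
Lemma separating_functional (v : V) : v != 0 -> exists phi : V -> R,
  [/\ forall x y, phi (x + y) = phi x + phi y,
      forall a x, phi (a *: x) = a * phi x,
      forall x, `|phi x| <= `|x| & phi v != 0].
Proof.
move=> v0; have hn : sublinear (fun x : V => `|x|).
  by split=> [x y|a x a0]; [exact: ler_normD|rewrite normrZ gtr0_norm].
have [phi [le_phi phiD phiZ]] := minimal_sublinear (sublinear_tiltP v hn).
have phiN x : phi (- x) = - phi x by rewrite -scaleN1r phiZ mulN1r.
have phi_le x : phi x <= `|x|.
  rewrite (le_trans (le_phi x))//.
  have := sublinear_tilt_le v x hn (lexx 0).
  by rewrite scale0r addr0 mul0r subr0.
exists phi; split => // [x|].
  by rewrite ler_norml phi_le andbT lerNl -phiN -(normrN x) phi_le.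
have : phi (- v) <= - `|v|.
  rewrite (le_trans (le_phi _))// (le_trans (sublinear_tilt_le _ _ hn ler01))//.
  by rewrite scale1r addNr normr0 mul1r sub0r.
rewrite phiN lerN2; apply: contraTneq => ->.
by rewrite -ltNge normr_gt0.
Qed.

End HahnBanach.

(** * Bochner integrals tested against bounded functionals *)

Section Scalarization.
Context (R : realType) (Y : normedModType R).

Definition bounded_functional (phi : Y -> R) : Prop :=
  [/\ forall x y, phi (x + y) = phi x + phi y,
      forall a x, phi (a *: x) = a * phi x &
      exists C, forall x, `|phi x| <= C * `|x|].

Variables (phi : Y -> R) (phi_bounded : bounded_functional phi).

Lemma functionalD x y : phi (x + y) = phi x + phi y.
Proof. by case: phi_bounded. Qed.

Lemma functionalZ a x : phi (a *: x) = a * phi x.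
Proof. by case: phi_bounded. Qed.

Lemma functional0 : phi 0 = 0.
Proof. by rewrite -(scale0r (0 : Y)) functionalZ mul0r. Qed.

Lemma functionalN x : phi (- x) = - phi x.
Proof. by rewrite -scaleN1r functionalZ mulN1r. Qed.

Lemma functionalB x y : phi (x - y) = phi x - phi y.
Proof. by rewrite functionalD functionalN. Qed.

Lemma functional_lipschitz : exists2 C, 0 < C & forall x, `|phi x| <= C * `|x|.
Proof.
have [_ _ [C hC]] := phi_bounded; exists (`|C| + 1); first by rewrite ltr_wpDl.
move=> x; rewrite (le_trans (hC x))// ler_wpM2r//.
by rewrite (le_trans (ler_norm C))// lerDl.
Qed.

Lemma functional_cvg (T : Type) (F : set_system T) (FF : Filter F) (f : T -> Y)
    (y : Y) : f @ F --> y -> (phi \o f) @ F --> phi y.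
Proof.
have [C C0 hC] := functional_lipschitz.
move=> /cvgrPdist_lt fy; apply/cvgrPdist_lt => e e0.
have Ce0 : 0 < C^-1 * e by rewrite mulr_gt0// invr_gt0.
apply: filterS (fy _ Ce0) => x hx.
by rewrite /= -functionalB (le_lt_trans (hC _))// -ltr_pdivlMl.
Qed.

Lemma functional_simple (D : set R) (s : seq (set R * Y)) : measurable D ->
    simple s ->
  leb.-integrable D (fun x => (phi (simple_eval s x))%:E) /\
  (\int[leb]_(x in D) (phi (simple_eval s x))%:E = (phi (simple_integral D s))%:E)%E.
Proof.
move=> mD; elim: s => [|[A y] s IH] hs.
  have E0 x : phi (simple_eval [::] x) = 0 by rewrite /simple_eval big_nil functional0.
  under eq_fun do rewrite E0.
  by rewrite /simple_integral big_nil functional0 integral0; split=> //; exact: integrable0.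
have [mA Aoo] : measurable A /\ (leb A < +oo)%E by apply: (hs (A, y)); rewrite mem_head.
have {IH} [Is Es] : leb.-integrable D (fun x => (phi (simple_eval s x))%:E) /\
  (\int[leb]_(x in D) (phi (simple_eval s x))%:E = (phi (simple_integral D s))%:E)%E.
  by apply: IH => p ps; apply: hs; rewrite inE ps orbT.
have E x : (phi (simple_eval ((A, y) :: s) x))%:E =
    ((phi y)%:E * (\1_A x)%:E + (phi (simple_eval s x))%:E)%E.
  by rewrite /simple_eval big_cons functionalD functionalZ/= EFinD EFinM muleC.
have DAoo : (leb (D `&` A) < +oo)%E.
  by rewrite (le_lt_trans _ Aoo)// le_measure ?inE//; exact: measurableI.
have IA : leb.-integrable D (fun x => (\1_A x)%:E).
  apply/integrableP; split.
    by apply/measurable_EFinP; exact: measurable_funTS.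
  under eq_integral do rewrite gee0_abs//.
  by rewrite integral_indic// setIC.
have IyA : leb.-integrable D (fun x => (phi y)%:E * (\1_A x)%:E)%E.
  exact: integrableZl.
rewrite (_ : (fun x => _) = (fun x => ((phi y)%:E * (\1_A x)%:E +
    (phi (simple_eval s x))%:E)%E)); last exact/funext.
split; first exact: integrableD.
rewrite integralD// Es integralZl// integral_indic// setIC.
rewrite /simple_integral big_cons functionalD functionalZ /= EFinD EFinM muleC.
by rewrite fineK// ge0_fin_numE.
Qed.

Lemma strongly_measurable_simple (D : set R) (s : seq (set R * Y)) :
  simple s -> strongly_measurable D (simple_eval s).
Proof. by move=> hs; exists (fun=> s); split => // x _; exact: cvg_cst. Qed.

(** A bounded functional commutes with integrals of simple functions, and both sides are limits of
    these. The scalar function [h] is [phi \o g] for the representative [g] in the definition of the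
    integral, since [f] itself is controlled only almost everywhere. *)
Lemma bochner_functional (D : set R) (f : R -> Y) (I : Y) : measurable D ->
    bochner_integral D f I ->
  exists h : R -> R, [/\ leb.-integrable D (EFin \o h),
    {ae leb, forall x, D x -> phi (f x) = h x} &
    (\int[leb]_(x in D) (h x)%:E = (phi I)%:E)%E].
Proof.
move=> mD [g [s [fg hs sg dist0 sI]]].
have [C C0 hC] := functional_lipschitz.
pose u n x := phi (simple_eval (s n) x).
have Iu n : leb.-integrable D (EFin \o u n) by exact: (functional_simple mD (hs n)).1.
have mh : measurable_fun D (phi \o g).
  apply: (@measurable_fun_cvg _ _ _ D u) => [n|x Dx].
    by apply/measurable_EFinP; exact: measurable_int (Iu n).
  by apply: functional_cvg; exact: sg.
have mdist n : measurable_fun D (fun x => `|g x - simple_eval (s n) x|).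
  have gm : strongly_measurable D g by exists s.
  have := measurable_norm_strong mD (strongly_measurable_lin (-1)
    (strongly_measurable_simple D (hs n)) gm).
  apply: eq_measurable_fun => x _.
  by rewrite -[(-1 *: _ + _) x]/(-1 *: simple_eval (s n) x + g x) scaleN1r addrC.
have le_dist n : (\int[leb]_(x in D) `|(phi (g x) - u n x)%:E| <=
    C%:E * \int[leb]_(x in D) (`|g x - simple_eval (s n) x|)%:E)%E.
  rewrite -ge0_integralZl//; last by rewrite lee_fin ltW.
    apply: ge0_le_integral => //.
    - apply/measurable_EFinP; apply: measurableT_comp => //.
      by apply: measurable_funB => //; apply/measurable_EFinP; exact: measurable_int (Iu n).
    - by apply: measurable_funeM; apply/measurable_EFinP; exact: mdist.
    - by move=> x _; rewrite -EFinM lee_fin -functionalB.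
  by apply/measurable_EFinP; exact: mdist.
(* The distances to the simple functions tend to 0, hence are finite for large [n]; one such [n]
   suffices for the integrability of [phi \o g]. *)
have Ih_near : \forall n \near \oo, leb.-integrable D (EFin \o (fun x => phi (g x) - u n x)).
  have /fine_cvgP[fin _] : (fun n => \int[leb]_(x in D) (`|g x - simple_eval (s n) x|)%:E)%E
     @ \oo --> (0 : R)%:E by exact: dist0.
  near=> n; apply/integrableP; split.
    apply/measurable_EFinP; apply: measurable_funB => //.
    by apply/measurable_EFinP; exact: measurable_int (Iu n).
  apply: le_lt_trans (le_dist n) _.
  rewrite lte_mul_pinfty ?lee_fin ?(ltW C0)// ltey_eq.
  by apply/orP; left; near: n.
have Ih : leb.-integrable D (EFin \o (phi \o g)).
  have [n _ hn] := Ih_near.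
  have : leb.-integrable D ((EFin \o (fun x => phi (g x) - u n x)%R) \+ (EFin \o u n))%E.
    by apply: integrableD => //; exact: (hn n (leqnn n)).
  by apply: eq_integrable => // x _ /=; rewrite -EFinD subrK.
exists (phi \o g); split => //.
  by move: fg; apply: ae_mono => x hx Dx; rewrite hx.
pose J := fine (\int[leb]_(x in D) (phi (g x))%:E).
have JE : (\int[leb]_(x in D) (phi (g x))%:E = J%:E)%E.
  by rewrite fineK//; exact: integrable_fin_num.
rewrite JE; congr EFin.
have uJ : (fun n => phi (simple_integral D (s n))) @ \oo --> J.
  apply/cvgrPdist_lt => e e0.
  have /fine_cvgP[fin dist0'] : (fun n => \int[leb]_(x in D) (`|g x - simple_eval (s n) x|)%:E)%E
     @ \oo --> (0 : R)%:E by exact: dist0.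
  have Ce0 : 0 < C^-1 * e by rewrite mulr_gt0// invr_gt0.
  move/cvgrPdist_lt : dist0' => /(_ _ Ce0) dist1.
  near=> n.
  rewrite -lte_fin.
  have -> : (`|J - phi (simple_integral D (s n))|%:E =
      `| \int[leb]_(x in D) (phi (g x) - u n x)%:E |)%E.
    rewrite -[X in `|X - _|%:E]/J -abse_EFin EFinB -JE -(functional_simple mD (hs n)).2.
    by congr (`| _ |)%E; apply/esym; apply: integralB_EFin; [|exact: Ih|exact: Iu].
  apply: le_lt_trans (le_abse_integral _ _ _) _ => //.
    apply/measurable_EFinP; apply: measurable_funB => //.
    by apply/measurable_EFinP; exact: measurable_int (Iu n).
  apply: le_lt_trans (le_dist n) _.
  have fn : (\int[leb]_(x in D) (`|g x - simple_eval (s n) x|)%:E)%E \is a fin_num.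
    by near: n.
  rewrite -(fineK fn) -EFinM lte_fin -ltr_pdivlMl//.
  rewrite (le_lt_trans (ler_norm _))// -normrN -sub0r.
  by near: n; exact: dist1.
exact: cvg_unique uJ (functional_cvg _ sI).
Unshelve. all: by end_near. Qed.

End Scalarization.

(** * Kernels as tail functions *)

Section Layers.
Context (R : realType).
Variables (n : R -> R) (c a : nat -> R).
Hypotheses (mn : measurable_fun setT n) (n0 : forall s, 0 <= n s).
Hypothesis c0 : forall k, 0 <= c k.
Local Open Scope ereal_scope.

Definition mass_below (g : R -> R) (s : R) : \bar R :=
  \int[leb]_(y in `]0%R, s[) (g y)%:E.

(** The integral of the primitive of [g] against the measure with density [n] and atoms of mass
    [c k] at [a k]. *)
Definition layers (g : R -> R) : \bar R :=
  \int[leb]_s ((n s)%:E * mass_below g s) +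
  \sum_(0 <= k <oo) (c k)%:E * mass_below g (a k).

(** The tail function of that measure: the mass of []y, +oo[] for positive [y], and 0 otherwise. *)
Definition density (y : R) : \bar R :=
  \int[leb]_s (if (0 < y) && (y < s) then n s else 0)%R%:E +
  \sum_(0 <= k <oo) (if (0 < y) && (y < a k) then c k else 0)%R%:E.

Lemma mass_belowE g s :
  mass_below g s = \int[leb]_y (if (0 < y) && (y < s) then g y else 0)%R%:E.
Proof.
rewrite /mass_below integral_mkcond; apply: eq_integral => y _.
by rewrite patchE mem_setE in_itv/=; case: ifP.
Qed.

Lemma mass_below_ge0 g s : (forall y, 0 <= g y)%R -> 0 <= mass_below g s.
Proof. by move=> g0; apply: integral_ge0 => y _; rewrite lee_fin. Qed.

Lemma measurable_between (g : R -> R) (s : R) : measurable_fun setT g ->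
  measurable_fun setT (fun y : R => (if (0 < y) && (y < s) then g y else 0)%R%:E).
Proof.
move=> mg; apply/measurable_EFinP; apply: measurable_fun_ifT => //.
by apply: measurable_and; apply: measurable_fun_ltr.
Qed.

Let F (g : R -> R) (z : measurableTypeR R * measurableTypeR R) : \bar R :=
  (if (0 < z.2) && (z.2 < z.1) then n z.1 * g z.2 else 0)%R%:E.

Let measurable_F (g : R -> R) : measurable_fun setT g -> measurable_fun setT (F g).
Proof.
move=> mg; apply/measurable_EFinP; apply: measurable_fun_ifT => //.
  by apply: measurable_and; apply: measurable_fun_ltr.
by apply: measurable_funM; apply: measurableT_comp.
Qed.

Let F_ge0 g : (forall y, 0 <= g y)%R -> forall z, 0 <= F g z.
Proof. by move=> g0 z; rewrite /F lee_fin; case: ifP => // _; exact: mulr_ge0. Qed.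

Let F_integral (g : R -> R) (s : R) : measurable_fun setT g -> (forall y, 0 <= g y)%R ->
  \int[leb]_y F g (s, y) = (n s)%:E * mass_below g s.
Proof.
move=> mg g0; rewrite mass_belowE -ge0_integralZl//.
- apply: eq_integral => y _; rewrite /F/= -EFinM; congr EFin.
  by case: ifP => _ //; rewrite mulr0.
- exact: measurable_between.
- by move=> y _; rewrite lee_fin; case: ifP.
- by rewrite lee_fin.
Qed.

Lemma measurable_mass_below (g : R -> R) : measurable_fun setT g -> (forall y, 0 <= g y)%R ->
  measurable_fun setT (fun s : R => (n s)%:E * mass_below g s).
Proof.
move=> mg g0.
have := measurable_fun_fubini_tonelli_F (m2 := leb) (F g) (measurable_F mg) (F_ge0 g0).
by apply: eq_measurable_fun => s _; rewrite -F_integral.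
Qed.

Lemma density_ge0 y : 0 <= density y.
Proof.
apply: adde_ge0.
  by apply: integral_ge0 => s _; rewrite lee_fin; case: ifP.
by apply: nneseries_ge0 => k _ _; rewrite lee_fin; case: ifP.
Qed.

(** Tonelli's theorem on the region [0 < y < s], for the density and for each atom. *)
Lemma layersE (g : R -> R) : measurable_fun setT g -> (forall y, 0 <= g y)%R ->
  measurable_fun setT density /\
  layers g = \int[leb]_y (density y * (g y)%:E).
Proof.
move=> mg g0.
pose one : R -> R := fun=> 1%R.
have m1 : measurable_fun setT one by exact: measurable_cst.
have one0 y : (0 <= one y)%R by rewrite ler01.
have md1 : measurable_fun setT (fun y : R => \int[leb]_s
    (if (0 < y) && (y < s) then n s else 0)%R%:E).
  have := measurable_fun_fubini_tonelli_G (m1 := leb) (F one) (measurable_F m1) (F_ge0 one0).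
  apply: eq_measurable_fun => y _; apply: eq_integral => s _.
  by rewrite /F/= mulr1.
have mck k : measurable_fun setT
    (fun y : R => (if (0 < y) && (y < a k) then c k else 0)%R%:E).
  exact: (@measurable_between (cst (c k))).
have md2 : measurable_fun setT (fun y : R => \sum_(0 <= k <oo)
    (if (0 < y) && (y < a k) then c k else 0)%R%:E).
  apply: ge0_emeasurable_sum => // k y _ _.
  by rewrite lee_fin; case: ifP.
split; first exact: emeasurable_funD.
have d1_ge0 y : 0 <= \int[leb]_s (if (0 < y) && (y < s) then n s else 0)%R%:E.
  by apply: integral_ge0 => s _; rewrite lee_fin; case: ifP.
have d2_ge0 y : 0 <= \sum_(0 <= k <oo)
    (if (0 < y) && (y < a k) then c k else 0)%R%:E.
  by apply: nneseries_ge0 => k _ _; rewrite lee_fin; case: ifP.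
have mg' : measurable_fun setT (EFin \o g) by exact/measurable_EFinP.
transitivity (\int[leb]_y ((\int[leb]_s (if (0 < y) && (y < s) then n s else 0)%R%:E)
    * (g y)%:E + (\sum_(0 <= k <oo) (if (0 < y) && (y < a k) then c k else 0)%R%:E)
    * (g y)%:E)); last first.
  by apply: eq_integral => y _; apply/esym; exact: ge0_muleDl.
rewrite ge0_integralD//; last 4 first.
- by move=> y _; rewrite mule_ge0 ?lee_fin.
- exact: emeasurable_funM.
- by move=> y _; rewrite mule_ge0 ?lee_fin.
- exact: emeasurable_funM.
rewrite /layers; congr (_ + _).
  transitivity (\int[leb]_s \int[leb]_y F g (s, y)).
    by apply: eq_integral => s _; rewrite F_integral.
  rewrite (fubini_tonelli (F g) (measurable_F mg) (F_ge0 g0)).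
  apply: eq_integral => y _; rewrite muleC -ge0_integralZl ?lee_fin//.
  - apply: eq_integral => s _; rewrite /F/= -EFinM; congr EFin.
    by case: ifP => _; rewrite ?mulr0// mulrC.
  - apply/measurable_EFinP; apply: measurable_fun_ifT => //.
    by apply: measurable_and; apply: measurable_fun_ltr.
  - by move=> s _; rewrite lee_fin; case: ifP.
transitivity (\sum_(0 <= k <oo) \int[leb]_y
    ((if (0 < y) && (y < a k) then c k else 0)%R%:E * (g y)%:E)).
  apply: eq_eseriesr => k _; rewrite mass_belowE -ge0_integralZl ?lee_fin//.
  - apply: eq_integral => y _; rewrite -!EFinM; congr EFin.
    by case: ifP => _; rewrite ?mulr0 ?mul0r.
  - exact: measurable_between.
  - by move=> y _; rewrite lee_fin; case: ifP.
rewrite -integral_nneseries//.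
- apply: eq_integral => y _; rewrite muleC -nneseriesZl ?lee_fin//.
    by apply: eq_eseriesr => k _; rewrite muleC.
  by move=> k _; rewrite lee_fin; case: ifP.
- by move=> k; apply: emeasurable_funM; [exact: mck|exact: mg'].
- by move=> k y _; rewrite mule_ge0 ?lee_fin//; case: ifP.
Qed.

(** Testing against indicators identifies [f] with the tail function almost everywhere on []0, t[];
    the identity then extends to all nonnegative [g] supported there. *)
Lemma layers_weight (t : R) (f : R -> R) :
    measurable_fun `]0%R, t[ f -> leb.-integrable `]0%R, t[ (EFin \o f) ->
    (forall A, measurable A -> A `<=` `]0%R, t[ ->
      \int[leb]_(y in A) (f y)%:E = layers \1_A) ->
  forall g : R -> R, measurable_fun setT g -> (forall y, 0 <= g y)%R ->
    (forall y, ~ (0 < y < t)%R -> g y = 0%R) ->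
  (forall y, (0 < y < t)%R -> (0 <= f y)%R) ->
  \int[leb]_(y in `]0%R, t[) (f y * g y)%:E = layers g.
Proof.
move=> mf If fA g mg g0 gt0 f0.
have [md ->] := layersE mg g0.
have mg' : measurable_fun setT (EFin \o g) by exact/measurable_EFinP.
have fd : ae_eq leb `]0%R, t[%classic (EFin \o f) density.
  apply: integral_ae_eq => //; first exact: measurable_funTS.
  move=> A At mA; rewrite (fA A mA At).
  have m1A : measurable_fun setT (\1_A : R -> R) by exact: measurable_indic.
  have i0 y : (0 <= (\1_A : R -> R) y)%R by [].
  have [_ ->] := layersE m1A i0.
  rewrite [RHS]integral_mkcond; apply: eq_integral => y _.
  by rewrite patchE indicE; case: (y \in A); rewrite ?mule1 ?mule0.
transitivity (\int[leb]_(y in `]0%R, t[) (density y * (g y)%:E)); last first.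
  rewrite [LHS]integral_mkcond; apply: eq_integral => y _.
  rewrite patchE; case: ifPn => // /negP yt; rewrite gt0 ?mule0// => y0t.
  by apply: yt; rewrite mem_setE in_itv.
apply: ge0_ae_eq_integral => //.
- by apply/measurable_EFinP; apply: measurable_funM => //; exact: measurable_funTS.
- by apply: measurable_funTS; exact: emeasurable_funM.
- by move=> y /=; rewrite in_itv/= => yt; rewrite lee_fin mulr_ge0// f0.
- by move=> y _; rewrite mule_ge0 ?density_ge0 ?lee_fin.
- move: fd; apply: ae_mono => y hy yt.
  by rewrite EFinM; congr (_ * _); exact: hy.
Qed.

End Layers.

(** * Almost everywhere representatives in weighted L2 spaces *)

Section WeightedL2Facts.
Context (R : realType) (w : weight R) (Y : normedModType R).

Lemma L2_integrand_measurable (f : R -> Y) : strongly_measurable Rpos f ->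
  measurable_fun Rpos (fun s => (w s * `|f s| ^+ 2)%:E).
Proof.
move=> mf; apply/measurable_EFinP; apply: measurable_funM.
  exact: weight_measurable.
by apply: measurable_funX; exact: measurable_norm_strong.
Qed.

Lemma L2_norm_eq0_ae (f : L2_fun w Y) : L2_norm f = 0 ->
  {ae leb, forall s, 0 < s -> w s != 0 -> f s = 0}.
Proof.
have [mf If] := L2_valP f; rewrite /L2_norm => /eqP; rewrite sqrtr_eq0 => I0.
have {}I0 : (\int[leb]_(s in Rpos) `|(w s * `|f s| ^+ 2)%:E| = 0)%E.
  transitivity (L2_integral w f).
    apply: eq_integral => s; rewrite inE RposE => s0.
    by rewrite gee0_abs// lee_fin mulr_ge0 ?weight_ge0// sqr_ge0.
  apply/eqP; rewrite eq_le L2_integral_ge0 andbT.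
  rewrite -(@fineK _ (L2_integral w f)) ?lee_fin//.
  by rewrite ge0_fin_numE ?L2_integral_ge0.
have := (ae_eq_integral_abs leb (@measurable_Rpos R) (L2_integrand_measurable mf)).1 I0.
apply: ae_mono => s hs s0 ws0.
have /hs/= : Rpos s by rewrite RposE.
move=> [] /eqP; rewrite mulf_eq0 (negPf ws0)/= sqrf_eq0 normr_eq0.
by move=> /eqP.
Qed.

Definition L2_class (f : L2_fun w Y) : L2 w Y :=
  (\pi_(seminorm_quotient (L2_seminorm w Y)) f)%qT.

Lemma L2_repr_class (f : L2_fun w Y) :
  {ae leb, forall s, 0 < s -> w s != 0 -> L2_repr (L2_class f) s = f s}.
Proof.
have := L2_norm_eq0_ae (seminorm_reprP (L2_seminorm w Y) f).
apply: ae_mono => s hs s0 ws0; rewrite /L2_repr (negPf ws0).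
by apply/eqP; rewrite -subr_eq0; apply/eqP; exact: hs.
Qed.

(** The choice of representatives is not additive, so the norm of [f - g] is computed on the
    difference of the chosen representatives instead of on the representative of the difference. *)
Lemma norm_L2B (f g : L2 w Y) :
  [/\ measurable_fun Rpos (fun s => (w s * `|L2_repr f s - L2_repr g s| ^+ 2)%:E) &
      ((`|f - g| ^+ 2)%:E = \int[leb]_(s in Rpos)
         (w s * `|L2_repr f s - L2_repr g s| ^+ 2)%:E)%E].
Proof.
set u : L2_fun w Y := repr (f : seminorm_quotient (L2_seminorm w Y)).
set v : L2_fun w Y := repr (g : seminorm_quotient (L2_seminorm w Y)).
have E s : w s * `|L2_repr f s - L2_repr g s| ^+ 2 = w s * `|(u - v) s| ^+ 2.
  by rewrite /L2_repr; case: ifPn => // /eqP ->; rewrite !mul0r.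
have [muv Iuv] := L2_valP (u - v).
under eq_fun do rewrite E.
split; first exact: L2_integrand_measurable.
rewrite (_ : `|f - g| = L2_norm (u - v)); last first.
  rewrite -[f]reprK -[g]reprK.
  have -> : (\pi_(seminorm_quotient (L2_seminorm w Y)) (repr f))%qT -
      (\pi_(seminorm_quotient (L2_seminorm w Y)) (repr g))%qT =
    (\pi_(seminorm_quotient (L2_seminorm w Y)) (u - v))%qT :> L2 w Y.
    rewrite -[RHS]seminorm_clsD; congr (_ + _).
    exact: seminorm_qoppE.
  exact: seminorm_qnormE.
rewrite /L2_norm sqr_sqrtr; last by rewrite fine_ge0// L2_integral_ge0.
by rewrite fineK// ge0_fin_numE// L2_integral_ge0.
Qed.

Lemma L2_repr_measurable (f : L2 w Y) :
  measurable_fun Rpos (fun s => (w s * `|L2_repr f s| ^+ 2)%:E).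
Proof.
rewrite (_ : (fun s => _) = (fun s => (w s *
    `|(repr (f : seminorm_quotient (L2_seminorm w Y)) : L2_fun w Y) s| ^+ 2)%:E)).
  by apply: L2_integrand_measurable; exact: (L2_valP _).1.
by apply/funext => s; rewrite /L2_repr; case: ifPn => // /eqP ->; rewrite !mul0r.
Qed.

Lemma sqr_norm_L2 (f : L2 w Y) :
  ((`|f| ^+ 2)%:E = \int[leb]_(s in Rpos) (w s * `|L2_repr f s| ^+ 2)%:E)%E.
Proof.
set u : L2_fun w Y := repr (f : seminorm_quotient (L2_seminorm w Y)).
have -> : (\int[leb]_(s in Rpos) (w s * `|L2_repr f s| ^+ 2)%:E = L2_integral w u)%E.
  apply: eq_integral => s _; congr EFin.
  by rewrite /L2_repr; case: ifPn => // /eqP ->; rewrite !mul0r.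
have [_ Iu] := L2_valP u.
rewrite (_ : `|f| = L2_norm u) //.
rewrite /L2_norm sqr_sqrtr; last by rewrite fine_ge0// L2_integral_ge0.
by rewrite fineK// ge0_fin_numE// L2_integral_ge0.
Qed.

End WeightedL2Facts.

(** * Support, derivative and jumps of the memory kernel *)

Section MemoryKernelFacts.
Context (R : realType) (K : memory_kernel R).

Lemma memory_kernel_vanishes (s t : R) : 0 < s -> s <= t -> K s = 0 -> K t = 0.
Proof.
move=> s0 st Ks; apply/eqP; rewrite eq_le -{1}Ks mu_nonincreasing//=.
by rewrite mu_ge0// (lt_le_trans s0).
Qed.

Lemma memory_kernel_derive1_le0 (u : R) : 0 < u -> derive1 K u <= 0.
Proof.
move=> u0; rewrite /derive1.
(* Where the difference quotients diverge, [derive1] has the default value 0. *)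
have [cK|] := pselect (cvg (h^-1 *: (K (h + u) - K u) @[h --> 0^'])); last first.
  by move/dvgP => ->.
apply: limr_le => //; near=> h.
have hu : `|h| < u.
  by near: h; have := @dnbhs0_lt R R^o u u0.
have hu0 : 0 < h + u by move: hu; rewrite ltr_norml => /andP[]; lra.
have [h0|h0|h0] := ltgtP 0 h; last by rewrite -h0 invr0 scale0r.
  rewrite [leLHS]/(_ * _) pmulr_rle0 ?invr_gt0// subr_le0.
  by rewrite mu_nonincreasing// lerDr ltW.
rewrite [leLHS]/(_ * _) nmulr_rle0 ?invr_lt0// subr_ge0.
by rewrite mu_nonincreasing// gerDr ltW.
Unshelve. all: by end_near. Qed.

(** At the endpoint of the support only the right difference quotients are known to vanish. A
    two-sided limit, if there is one, agrees with the right limit; otherwise the default value is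
    0. *)
Lemma memory_kernel_derive1_eq0 (u : R) : 0 < u -> K u = 0 -> derive1 K u = 0.
Proof.
move=> u0 Ku; rewrite /derive1.
have [cK|] := pselect (cvg (h^-1 *: (K (h + u) - K u) @[h --> 0^'])); last first.
  by move/dvgP => ->.
have cr : (h^-1 *: (K (h + u) - K u) @[h --> 0^'+]) -->
    lim (h^-1 *: (K (h + u) - K u) @[h --> 0^']).
  exact: cvg_dnbhs_at_right.
have c0 : (h^-1 *: (K (h + u) - K u) @[h --> 0^'+]) --> (0 : R).
  apply: cvg_near_cst; near=> h.
  have h0 : 0 < h by [].
  by rewrite Ku (@memory_kernel_vanishes u)// ?lerDr ?ltW// subrr scaler0.
exact: (cvg_unique _ cr c0).
Unshelve. all: by end_near. Qed.

(** A kernel that vanishes at [u] vanishes from there on, which leaves no room for a later jump of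
    positive size. *)
Lemma memory_kernel_jump_neq0 (n : nat) (u : R) :
  is_jump K n -> 0 < u -> u < jump_at K n -> K u != 0.
Proof.
move=> jn u0 un; apply/eqP => Ku.
have := jump_size_gt0 jn; rewrite /jump_size.
rewrite (memory_kernel_vanishes u0 (ltW un) Ku) subr0.
suff -> : lim (K x @[x --> (jump_at K n)^'-]) = 0 by rewrite ltxx.
apply: cvg_lim => //; apply: cvg_near_cst; near=> x.
by apply: memory_kernel_vanishes u0 _ Ku; rewrite ltW.
Unshelve. all: by end_near. Qed.

Lemma memory_kernel_shift_measurable (tau : R) : 0 < tau ->
  measurable_fun Rpos (fun s => K (tau + s)).
Proof.
move=> tau0; apply: (@measurable_comp _ _ _ _ _ _ Rpos).
- exact: measurable_Rpos.
- by move=> _ [s + <-]; rewrite !RposE => s0; rewrite addr_gt0.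
- exact: mu_measurable.
- exact: measurable_funD.
Qed.

End MemoryKernelFacts.

(* [measurable_Rpos] restated in the display of the domain of [leb], where
   automation does not see the former. *)
Lemma measurable_Rpos_leb (R : realType) :
  measurable (Rpos : set (measurableTypeR R)).
Proof. exact: measurable_Rpos. Qed.
#[local] Hint Resolve measurable_Rpos_leb : core.

(** * The identity for Lambda on step functions *)

Section StepIdentity.
Context (R : realType) (K : memory_kernel R) (Y : normedModType R).

Lemma step_L2 (A : set R) (y : Y) : measurable A -> (leb A < +oo)%E ->
  (fun s => (\1_A s : R) *: y) \in @L2_pred R (mu_weight K) Y.
Proof.
move=> mA Aoo; apply/mem_set; split.
  exists (fun=> [:: (A, y)]); split.
    by move=> _ p; rewrite inE => /eqP ->.
  move=> x _; under eq_fun do rewrite /simple_eval big_seq1.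
  exact: cvg_cst.
have [mK IK] := integrableP _ _ _ (mu_integrable K).
have mA1 : measurable_fun setT (\1_A : R -> R) by exact: measurable_indic.
apply: (@le_lt_trans _ _ (\int[leb]_(s in Rpos) ((`|y| ^+ 2)%:E * `|(K s)%:E|))%E).
  apply: ge0_le_integral => //.
  - by move=> s; rewrite RposE => s0; rewrite lee_fin mulr_ge0 ?sqr_ge0// weight_ge0.
  - apply/measurable_EFinP; apply: measurable_funM; first exact: mu_measurable.
    apply: measurable_funX; apply: (eq_measurable_fun (fun s => \1_A s * `|y|)).
      by move=> s _; rewrite normrZ ger0_norm.
    by apply: measurable_funTS; exact: measurable_funM.
  - by apply: measurable_funeM; exact: measurableT_comp.
  - move=> s; rewrite RposE => s0 /=.
    rewrite ger0_norm ?mu_ge0// -EFinM lee_fin mulrC ler_wpM2r ?mu_ge0//.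
    by rewrite normrZ ger0_norm// exprMn ler_piMl ?sqr_ge0.
rewrite ge0_integralZl// ?lte_mul_pinfty ?lee_fin ?sqr_ge0//.
exact: measurableT_comp.
Qed.

Definition step_class (A : set R) (y : Y) (mA : measurable A)
    (Aoo : (leb A < +oo)%E) : M0 K Y :=
  L2_class (L2Fun (step_L2 y mA Aoo)).

Lemma hfun_step (A : set R) (y : Y) (mA : measurable A) (Aoo : (leb A < +oo)%E) :
  mu_ae K (fun s => hfun (step_class y mA Aoo) s = (\1_A s : R) *: y).
Proof. exact: (@L2_repr_class _ (mu_weight K) _ (L2Fun (step_L2 y mA Aoo))). Qed.

Variables (y0 : Y) (phi : Y -> R).
Hypotheses (phi_bounded : bounded_functional phi) (phi1 : phi y0 = 1).
Variable Lambda : M0 K Y -> S0 K Y.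
Hypothesis Lambda_id : Lambda_identity Lambda.
Variables (tau : R) (tau0 : 0 < tau).

(** [Lambda_identity] for the class of [\1_A *: y0], read through [phi]: since [phi y0 = 1], the
    primitive becomes the length of the part of [A] below [s]. *)
Lemma Lambda_identity_step (A : set R) : measurable A -> (leb A < +oo)%E ->
  exists (h : R -> R) (c : R), [/\ leb.-integrable Rpos (EFin \o h),
    {ae leb, forall s, 0 < s ->
       derive1 K (tau + s) * fine (leb (A `&` `]0, s[%classic)) = h s},
    (fun N => \sum_(0 <= n < N | is_jump K n && (tau < jump_at K n))
       jump_size K n * fine (leb (A `&` `]0, jump_at K n - tau[%classic)))
      @ \oo --> c &
    (\int[leb]_(s in Rpos) (K (tau + s) * \1_A s)%:E =
      c%:E - \int[leb]_(s in Rpos) (h s)%:E)%E].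
Proof.
move=> mA Aoo; set eta := step_class y0 mA Aoo.
have eta_ae : mu_ae K (fun s => phi (hfun eta s) = \1_A s).
  move: (hfun_step y0 mA Aoo); apply: ae_mono => s hs s0 Ks.
  by rewrite hs// (functionalZ phi_bounded) phi1 mulr1.
have mA1 : measurable_fun setT (\1_A : R -> R) by exact: measurable_indic.
have [I [H [hI _ hH [I1 [I2 [hI1 hI2 IE]]]]]] := Lambda_id eta tau0.
have phiH s : 0 < s -> K s != 0 -> phi (H s) = fine (leb (A `&` `]0, s[%classic)).
  move=> s0 Ks.
  have [h [Ih hE hint]] :=
    bochner_functional phi_bounded (measurable_itv `]0, s[) (hH s s0 Ks).
  transitivity (fine (\int[leb]_(x in `]0%R, s[) (h x)%:E)); first by rewrite hint.
  congr fine; transitivity (\int[leb]_(x in `]0%R, s[) (\1_A x)%:E)%E; last first.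
    by rewrite integral_indic.
  apply: ae_eq_integral => //.
  - exact: measurable_int Ih.
  - by apply/measurable_EFinP; exact: measurable_funTS.
  - move: (ae_and hE eta_ae); apply: ae_mono => x [hx ex] xs.
    rewrite /= -hx//; move: xs; rewrite /= in_itv/= => /andP[x0 xs].
    by rewrite ex//; apply: contra Ks => /eqP/(memory_kernel_vanishes x0 (ltW xs))/eqP.
have [k [Ik kE kint]] := bochner_functional phi_bounded (@measurable_Rpos R) hI.
have [h [Ih hE hint]] := bochner_functional phi_bounded (@measurable_Rpos R) hI1.
exists h, (phi I2); split=> //.
- move: hE; apply: ae_mono => s hs s0; rewrite -hs ?RposE//.
  rewrite (functionalZ phi_bounded).
  (* Where [K s = 0] the primitive [H s] is unknown, but its coefficient [derive1 K (tau + s)]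
     vanishes. *)
  have [Ks|Ks] := eqVneq (K s) 0; last by rewrite phiH.
  rewrite memory_kernel_derive1_eq0 ?mul0r ?addr_gt0//.
  by apply: memory_kernel_vanishes s0 _ Ks; rewrite lerDr ltW.
- rewrite (_ : (fun N => _) = phi \o (fun N =>
      \sum_(0 <= n < N | is_jump K n && (tau < jump_at K n))
        jump_size K n *: H (jump_at K n - tau))).
    exact: functional_cvg.
  apply/funext => N; rewrite /=; apply/esym.
  elim/big_ind2: _ => [|x1 x2 y1 y2 <- <-|n /andP[jn taun]].
  + by rewrite (functional0 phi_bounded).
  + by rewrite (functionalD phi_bounded).
  + rewrite (functionalZ phi_bounded) phiH ?subr_gt0//.
    apply: memory_kernel_jump_neq0 jn _ _; first by rewrite subr_gt0.
    by rewrite ltrBlDr ltrDl.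
- transitivity (\int[leb]_(s in Rpos) (k s)%:E)%E.
    apply: ae_eq_integral => //.
    + apply/measurable_EFinP; apply: measurable_funM.
        exact: memory_kernel_shift_measurable.
      exact: measurable_funTS.
    + exact: measurable_int Ik.
    + move: (ae_and kE eta_ae); apply: ae_mono => s [hs es] Rs.
      rewrite /= -hs// (functionalZ phi_bounded); move: Rs; rewrite RposE => s0.
      have [Ks|Ks] := eqVneq (K s) 0; last by rewrite es.
      rewrite (memory_kernel_vanishes s0 _ Ks) ?mul0r//.
      by rewrite lerDr ltW.
  rewrite kint hint IE (functionalD phi_bounded) (functionalN phi_bounded).
  by rewrite EFinD EFinN addeC.
Qed.

End StepIdentity.

(** * The shifted kernel as the tail function of a measure *)

Section KernelLayers.
Context (R : realType) (K : memory_kernel R) (tau : R).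
Hypothesis tau0 : 0 < tau.

Lemma eseries_EFin (u : nat -> R) (l : R) :
  (fun N => \sum_(0 <= k < N) u k) @ \oo --> l ->
  (\sum_(0 <= k <oo) (u k)%:E = l%:E)%E.
Proof.
move=> ul; apply: cvg_lim => //.
rewrite (_ : (fun N => _) = EFin \o (fun N => \sum_(0 <= k < N) u k)).
  by apply: cvg_EFin; [exact: nearW|exact: ul].
by apply/funext => N; rewrite /= sumEFin.
Qed.

Lemma mass_below_le0 (g : R -> R) (s : R) : s <= 0 -> mass_below g s = 0%E.
Proof.
move=> s0; rewrite /mass_below set_itv_ge ?integral_set0//.
by rewrite bnd_simp -leNgt.
Qed.

Lemma mass_below_indic (A : set R) (s : R) : measurable A ->
  mass_below \1_A s = (fine (leb (A `&` `]0, s[%classic)))%:E.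
Proof.
move=> mA; rewrite /mass_below integral_indic// fineK//.
rewrite ge0_fin_numE//; apply: (@le_lt_trans _ _ (leb (`]0, s[%classic : set R))).
  by apply: le_measure; rewrite ?inE//; exact: measurableI.
by rewrite lebesgue_measure_itv/=; case: ifP => // _; rewrite ltry.
Qed.

Lemma layers_Rpos (n : R -> R) (c a : nat -> R) (g : R -> R) :
  layers n c a g = (\int[leb]_(s in Rpos) ((n s)%:E * mass_below g s) +
    \sum_(0 <= k <oo) (c k)%:E * mass_below g (a k))%E.
Proof.
rewrite /layers; congr (_ + _)%E; rewrite [RHS]integral_mkcond.
apply: eq_integral => s _; rewrite patchE; case: ifPn => // /negP s0.
rewrite mass_below_le0 ?mule0// leNgt; apply/negP => s1.
by apply: s0; rewrite inE RposE.
Qed.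

(** Zero weights stand for absent jumps and for those not beyond [tau], so that the atoms are
    indexed by all of [nat]. *)
Definition jump_weight (k : nat) : R :=
  if is_jump K k && (tau < jump_at K k) then jump_size K k else 0.

Lemma jump_weight_ge0 k : 0 <= jump_weight k.
Proof. by rewrite /jump_weight; case: ifP => // /andP[/jump_size_gt0/ltW]. Qed.

Context (Y : normedModType R) (y0 : Y) (phi : Y -> R).
Hypotheses (phi_bounded : bounded_functional phi) (phi1 : phi y0 = 1).
Variable Lambda : M0 K Y -> S0 K Y.
Hypothesis Lambda_id : Lambda_identity Lambda.

(** A measurable version of the derivative is read off the step identity for []0, 1[]: there [h s]
    is [derive1 K (tau + s)] times [Num.min 1 s] almost everywhere, and the second factor is
    positive. *)
Lemma kernel_density : exists n : R -> R, [/\ measurable_fun setT n,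
  forall s, 0 <= n s & {ae leb, forall s, 0 < s -> n s = - derive1 K (tau + s)}].
Proof.
have [|h [_ [Ih hE _ _]]] := Lambda_identity_step phi_bounded phi1 Lambda_id tau0
  (measurable_itv `]0, 1[ : measurable (`]0, 1[%classic : set R)).
  by rewrite lebesgue_measure_itv/= lte_fin ltr01 ltry.
have leb1 s : 0 < s -> fine (leb (`]0, 1[%classic `&` `]0, s[%classic)) = Num.min 1 s.
  move=> s0; rewrite (_ : _ `&` _ = `]0, Num.min 1 s[%classic).
    by rewrite lebesgue_measure_itv/= lte_fin lt_min ltr01 s0/= oppr0 addr0.
  apply/seteqP; split => x /=; rewrite !in_itv/= lt_min.
    by move=> [/andP[-> ->] /andP[_ ->]].
  by move=> /and3P[-> -> ->].
(* The maximum enforces nonnegativity everywhere; it changes nothing almost everywhere, as the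
   kernel is nonincreasing. *)
pose q s := Num.max (- (h s / Num.min 1 s)) 0.
exists (q \_ Rpos); split.
- apply/(measurable_restrictT _ (@measurable_Rpos R)).
  apply: measurable_maxr => //; apply: measurableT_comp => //.
  apply: measurable_funM; first by apply/measurable_EFinP; exact: measurable_int Ih.
  apply: (eq_measurable_fun (fun s : R => (Num.min 1 s) `^ (-1))).
  + move=> s; rewrite inE RposE => s0.
    by rewrite powR_inv1// le_min ler01 ltW.
  + apply: (@measurableT_comp _ _ _ _ _ _ (@powR R ^~ (-1))) => //.
    exact: measurable_minr.
- by move=> s; rewrite patchE; case: ifP => // _; rewrite le_max lexx orbT.
- move: hE; apply: ae_mono => s hs s0.
  rewrite patchE ifT; last by rewrite inE RposE.
  rewrite /q -hs// leb1// mulfK; last by rewrite gt_eqF// lt_min ltr01.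
  by apply/max_idPl; rewrite oppr_ge0 memory_kernel_derive1_le0// addr_gt0.
Qed.

Variable n : R -> R.
Hypotheses (mn : measurable_fun setT n) (n0 : forall s, 0 <= n s).
Hypothesis nE : {ae leb, forall s, 0 < s -> n s = - derive1 K (tau + s)}.

Let lay := layers n jump_weight (fun k => jump_at K k - tau).

Lemma kernel_layers_indic (A : set R) : measurable A -> (leb A < +oo)%E ->
  A `<=` Rpos -> (\int[leb]_(s in A) (K (tau + s))%:E = lay \1_A)%E.
Proof.
move=> mA Aoo A0.
have [h [c [Ih hE hc hint]]] :=
  Lambda_identity_step phi_bounded phi1 Lambda_id tau0 mA Aoo.
transitivity (\int[leb]_(s in Rpos) (K (tau + s) * \1_A s)%:E)%E.
  rewrite integral_mkcond [RHS]integral_mkcond; apply: eq_integral => s _.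
  rewrite !patchE indicE; case: ifPn => sA.
    by rewrite ifT ?mulr1// inE; apply: A0; exact: set_mem.
  by rewrite mulr0 if_same.
rewrite hint /lay layers_Rpos [LHS]addeC; congr (_ + _)%E; last first.
  have -> : c%:E = (\sum_(0 <= k <oo) (jump_weight k *
      fine (leb (A `&` `]0%R, (jump_at K k - tau)%R[%classic)))%:E)%E.
    apply/esym/eseries_EFin; apply: cvg_trans hc; apply: near_eq_cvg.
    apply: nearW => N; rewrite [LHS]big_mkcond; apply: eq_bigr => k _.
    by rewrite /jump_weight; case: ifP => // _; rewrite mul0r.
  by apply: eq_eseriesr => k _; rewrite mass_below_indic// EFinM.
have mh := measurable_int _ Ih.
rewrite -integralN//; last first.
  by apply: fin_num_adde_defl; rewrite fin_numN; exact: integrable_neg_fin_num.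
apply: ae_eq_integral => //.
- exact: measurableT_comp.
- apply: measurable_funTS; apply: (@measurable_mass_below _ n) => //.
- move: (ae_and hE nE); apply: ae_mono => s [hs ns]; rewrite RposE => s0.
  by rewrite mass_below_indic// ns// -EFinM mulNr hs// EFinN.
Qed.

(** [layers_weight] applies with [K (tau + s)] as weight: it is bounded by [K tau], hence integrable
    on []0, t[], and its integrals over measurable subsets are given by [kernel_layers_indic]. *)
Lemma kernel_layers (t : R) (g : R -> R) : measurable_fun setT g ->
    (forall s, 0 <= g s) -> (forall s, ~ (0 < s < t) -> g s = 0) ->
  (\int[leb]_(s in `]0%R, t[) (K (tau + s) * g s)%:E = lay g)%E.
Proof.
move=> mg g0 gt.
have sub : (`]0, t[%classic : set R) `<=` Rpos.
  by move=> s /=; rewrite RposE in_itv/= => /andP[].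
have mK : measurable_fun `]0, t[ (fun s => K (tau + s)).
  apply: measurable_funS (memory_kernel_shift_measurable K tau0) => //.
  exact: measurable_Rpos.
have tau_pos s : 0 < s -> 0 < tau + s by move=> s0; rewrite addr_gt0.
have K0 s : 0 < s < t -> 0 <= K (tau + s).
  by move=> /andP[s0 _]; rewrite mu_ge0// tau_pos.
have leb_fin : (leb (`]0%R, t[%classic : set R) < +oo)%E.
  by rewrite lebesgue_measure_itv/=; case: ifP => // _; rewrite ltry.
rewrite /lay.
apply: (@layers_weight _ _ _ _ mn n0 jump_weight_ge0 t (fun s => K (tau + s))) => //.
  apply/integrableP; split; first exact/measurable_EFinP.
  apply: (@le_lt_trans _ _ (\int[leb]_(s in `]0%R, t[) (K tau)%:E)%E).
    apply: ge0_le_integral => //.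
    - by apply: measurableT_comp => //; exact/measurable_EFinP.
    - move=> s /=; rewrite in_itv/= => st.
      rewrite ger0_norm ?K0// lee_fin mu_nonincreasing// lerDl ltW//.
      by case/andP: st.
  by rewrite integral_cst// lte_mul_pinfty ?lee_fin ?mu_ge0.
move=> A mA At; apply: kernel_layers_indic => //.
  by apply: le_lt_trans leb_fin; apply: le_measure; rewrite ?inE.
exact: subset_trans At sub.
Qed.

End KernelLayers.

(** * Integration by parts against the kernel for signed functions *)

Section SignedKernelLayers.
Context (R : realType).

Lemma integralE_max (D : set R) (g : R -> R) : measurable D ->
    leb.-integrable D (EFin \o g) ->
  [/\ leb.-integrable D (fun s => (Num.max (g s) 0)%:E),
      leb.-integrable D (fun s => (Num.max (- g s) 0)%:E) &
      (\int[leb]_(s in D) (g s)%:E = \int[leb]_(s in D) (Num.max (g s) 0)%:E -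
        \int[leb]_(s in D) (Num.max (- g s) 0)%:E)%E].
Proof.
move=> mD Ig.
have pE : (EFin \o g)^\+%E = (fun s => (Num.max (g s) 0)%:E).
  by apply/funext => s; rewrite funeposE /= -EFin_max.
have qE : (EFin \o g)^\-%E = (fun s => (Num.max (- g s) 0)%:E).
  by apply/funext => s; rewrite funenegE /= -EFin_max.
split.
- by rewrite -pE; exact: integrable_funepos.
- by rewrite -qE; exact: integrable_funeneg.
- by rewrite integralE -pE -qE.
Qed.

Lemma nneseries_partial_cvg (u : nat -> R) (s : \bar R) : (forall k, 0 <= u k) ->
  s = (\sum_(0 <= k <oo) (u k)%:E)%E -> s \is a fin_num ->
  (fun N => \sum_(0 <= k < N) u k) @ \oo --> fine s.
Proof.
move=> u0 sE sfin.
have : (fun N => \sum_(0 <= k < N) (u k)%:E)%E @ \oo --> (fine s)%:E.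
  by rewrite fineK// sE; apply: is_cvg_nneseries => k _; rewrite lee_fin.
move=> /fine_cvg; apply: cvg_trans; apply: near_eq_cvg; apply: nearW => N /=.
by rewrite sumEFin.
Qed.

Variables (K : memory_kernel R) (tau : R).
Hypothesis tau0 : 0 < tau.
Context (Y : normedModType R) (y0 : Y) (phi : Y -> R).
Hypotheses (phi_bounded : bounded_functional phi) (phi1 : phi y0 = 1).
Variable Lambda : M0 K Y -> S0 K Y.
Hypothesis Lambda_id : Lambda_identity Lambda.

(** The tail identity holds for the positive and the negative part of [g]. Integrability of the
    product makes all contributions finite, so they may be subtracted: the density parts give [h]
    and the jump parts give [c]. *)
Lemma kernel_integral_by_parts (t : R) (g G h : R -> R) (c : R) :
    measurable_fun setT g -> (forall s, ~ (0 < s < t) -> g s = 0) ->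
    leb.-integrable `]0, t[ (EFin \o (fun s => K (tau + s) * g s)) ->
    {ae leb, forall s, 0 < s -> K (tau + s) != 0 ->
       leb.-integrable `]0, s[ (EFin \o g) /\
       (\int[leb]_(y in `]0%R, s[) (g y)%:E = (G s)%:E)%E} ->
    (forall k, is_jump K k -> tau < jump_at K k ->
       leb.-integrable `]0, jump_at K k - tau[ (EFin \o g) /\
       (\int[leb]_(y in `]0%R, (jump_at K k - tau)%R[) (g y)%:E =
         (G (jump_at K k - tau))%:E)%E) ->
    leb.-integrable Rpos (EFin \o h) ->
    {ae leb, forall s, 0 < s -> derive1 K (tau + s) * G s = h s} ->
    (fun N => \sum_(0 <= k < N | is_jump K k && (tau < jump_at K k))
       jump_size K k * G (jump_at K k - tau)) @ \oo --> c ->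
  (\int[leb]_(s in `]0%R, t[) (K (tau + s) * g s)%:E =
    c%:E - \int[leb]_(s in Rpos) (h s)%:E)%E.
Proof.
move=> mg gt IKg hG hJ Ih hE hc.
have [n [mn n0 nE]] := kernel_density tau0 phi_bounded phi1 Lambda_id.
pose p s := Num.max (g s) 0; pose q s := Num.max (- g s) 0.
pose a k := jump_at K k - tau.
have mp : measurable_fun setT p by exact: measurable_maxr.
have mq : measurable_fun setT q.
  by apply: measurable_maxr => //; exact: measurableT_comp.
have p0 s : 0 <= p s by rewrite le_max lexx orbT.
have q0 s : 0 <= q s by rewrite le_max lexx orbT.
have lay r := kernel_layers tau0 phi_bounded phi1 Lambda_id mn n0 nE (t := t) (g := r).
have layp := lay p mp p0 (fun s st => ltac:(by rewrite /p gt// maxxx)).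
have layq := lay q mq q0 (fun s st => ltac:(by rewrite /q gt// oppr0 maxxx)).
have KM r s : 0 < s < t -> Num.max (K (tau + s) * r) 0 = K (tau + s) * Num.max r 0.
  move=> /andP[s0 _]; rewrite -[in LHS](mulr0 (K (tau + s))) maxr_pMr//.
  by rewrite mu_ge0// addr_gt0.
have [Ip Iq IE] := integralE_max (measurable_itv `]0, t[) IKg.
have pE : (\int[leb]_(s in `]0%R, t[) (Num.max (K (tau + s) * g s) 0)%:E =
    layers n (jump_weight K tau) a p)%E.
  rewrite -layp; apply: eq_integral => s; rewrite inE/= in_itv/= => st.
  by rewrite KM.
have qE : (\int[leb]_(s in `]0%R, t[) (Num.max (- (K (tau + s) * g s)) 0)%:E =
    layers n (jump_weight K tau) a q)%E.
  rewrite -layq; apply: eq_integral => s; rewrite inE/= in_itv/= => st.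
  by rewrite -mulrN KM.
have pfin : layers n (jump_weight K tau) a p \is a fin_num.
  by rewrite -pE; exact: integrable_fin_num.
have qfin : layers n (jump_weight K tau) a q \is a fin_num.
  by rewrite -qE; exact: integrable_fin_num.
rewrite IE pE qE; move: pfin qfin; rewrite !layers_Rpos.
set ap := (\int[leb]_(s in Rpos) _)%E.
set aq := (\int[leb]_(s in Rpos) ((n s)%:E * mass_below q s))%E.
set sp := (\sum_(0 <= k <oo) _)%E.
set sq := (\sum_(0 <= k <oo)
  ((jump_weight K tau k)%:E * mass_below q (a k)))%E.
have wm0 (r : R -> R) (s x : R) :
    (forall y, 0 <= r y) -> 0 <= x -> (0 <= x%:E * mass_below r s)%E.
  by move=> r0 x0; rewrite mule_ge0 ?lee_fin// mass_below_ge0.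
have ge0 (r : R -> R) : (forall y, 0 <= r y) ->
    (0 <= \int[leb]_(s in Rpos) ((n s)%:E * mass_below r s))%E /\
    (0 <= \sum_(0 <= k <oo) ((jump_weight K tau k)%:E * mass_below r (a k)))%E.
  move=> r0; split; first by apply: integral_ge0 => s _; rewrite wm0.
  by apply: nneseries_ge0 => k _ _; rewrite wm0// jump_weight_ge0.
have [[ap0 sp0] [aq0 sq0]] := (ge0 p p0, ge0 q q0).
(* Finiteness of a sum of nonnegative terms separates the density contribution from the jump
   contribution, for each sign. *)
have fin (x y : \bar R) : (0 <= x -> 0 <= y -> x + y \is a fin_num ->
    x \is a fin_num /\ y \is a fin_num)%E.
  by case: x y => [x| |] [y| |].
move=> /fin-/(_ ap0 sp0)[apf spf] /fin-/(_ aq0 sq0)[aqf sqf].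
have IP (r : R -> R) : (forall y, 0 <= r y) -> measurable_fun setT r ->
    (\int[leb]_(s in Rpos) ((n s)%:E * mass_below r s))%E \is a fin_num ->
    leb.-integrable Rpos (fun s => ((n s)%:E * mass_below r s)%E).
  move=> r0 mr rfin; apply/integrableP; split.
    by apply: measurable_funTS; exact: measurable_mass_below.
  under eq_integral do rewrite gee0_abs ?wm0//.
  by rewrite -ge0_fin_numE// (ge0 r r0).1.
have Inp := IP p p0 mp apf; have Inq := IP q q0 mq aqf.
have massE s : leb.-integrable `]0, s[ (EFin \o g) ->
    (\int[leb]_(y in `]0%R, s[) (g y)%:E = (G s)%:E)%E ->
    [/\ mass_below p s \is a fin_num, mass_below q s \is a fin_num &
      G s = fine (mass_below p s) - fine (mass_below q s)].
  move=> Ig gE; have [Igp Igq gE'] := integralE_max (measurable_itv `]0, s[) Ig.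
  have fp : mass_below p s \is a fin_num by exact: integrable_fin_num.
  have fq : mass_below q s \is a fin_num by exact: integrable_fin_num.
  by split=> //; apply: EFin_inj; rewrite -gE gE' EFinB !fineK.
have hdiff : (ap - aq = - \int[leb]_(s in Rpos) (h s)%:E)%E.
  rewrite -[RHS]integralN; last first.
    by apply: fin_num_adde_defl; rewrite fin_numN; exact: integrable_neg_fin_num.
  transitivity (\int[leb]_(s in Rpos)
      ((n s)%:E * mass_below p s - (n s)%:E * mass_below q s))%E.
    by apply/esym; exact: (integralB (@measurable_Rpos_leb R) Inp Inq).
  apply: ae_eq_integral => //.
  - apply: emeasurable_funB; [exact: measurable_int Inp|exact: measurable_int Inq].
  - by apply: measurableT_comp => //; exact: measurable_int Ih.
  - move: (ae_and hE (ae_and hG nE)); apply: ae_mono => s [hs [Gs ns]].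
    rewrite RposE => s0; have := hs s0; rewrite /= => <-; rewrite ns//.
    (* Beyond the support [G s] need not be the primitive of [g], but the derivative of the kernel
       vanishes. *)
    have [K0|K0] := eqVneq (K (tau + s)) 0.
      rewrite memory_kernel_derive1_eq0 ?addr_gt0// oppr0 !mul0e.
      by rewrite mul0r oppr0 sube0.
    have [fp fq ->] := massE s (Gs s0 K0).1 (Gs s0 K0).2.
    rewrite -(fineK fp) -(fineK fq) -!EFinM -EFinB; congr EFin => /=.
    by ring.
pose u k := jump_weight K tau k * fine (mass_below p (a k)).
pose v k := jump_weight K tau k * fine (mass_below q (a k)).
have massJ k : is_jump K k && (tau < jump_at K k) -> _ :=
  fun jk => massE (a k) (hJ k (andP jk).1 (andP jk).2).1 (hJ k (andP jk).1 (andP jk).2).2.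
have spE : sp = (\sum_(0 <= k <oo) (u k)%:E)%E.
  apply: eq_eseriesr => k _; rewrite /u /jump_weight.
  by case: ifPn => [/massJ[fp _ _]|_]; [by rewrite EFinM fineK|by rewrite mul0r mul0e].
have sqE : sq = (\sum_(0 <= k <oo) (v k)%:E)%E.
  apply: eq_eseriesr => k _; rewrite /v /jump_weight.
  by case: ifPn => [/massJ[_ fq _]|_]; [by rewrite EFinM fineK|by rewrite mul0r mul0e].
have u0 k : 0 <= u k by rewrite mulr_ge0 ?jump_weight_ge0// fine_ge0// mass_below_ge0.
have v0 k : 0 <= v k by rewrite mulr_ge0 ?jump_weight_ge0// fine_ge0// mass_below_ge0.
have cE : c = fine sp - fine sq.
  suff hd : (fun N => \sum_(0 <= k < N | is_jump K k && (tau < jump_at K k))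
      jump_size K k * G (jump_at K k - tau)) @ \oo --> fine sp - fine sq.
    exact: (cvg_unique _ hc hd).
  rewrite (_ : (fun N => _) = (fun N => \sum_(0 <= k < N) u k - \sum_(0 <= k < N) v k)).
    apply: cvgB; first exact: nneseries_partial_cvg spf.
    exact: nneseries_partial_cvg sqf.
  apply/funext => N; apply/esym.
  rewrite [RHS]big_mkcond -sumrB; apply: eq_bigr => k _.
  rewrite /u /v /jump_weight; case: ifPn => [/massJ[_ _ ->]|_].
    by rewrite mulrBr.
  by rewrite !mul0r subrr.
rewrite cE -hdiff -(fineK apf) -(fineK aqf) -(fineK spf) -(fineK sqf).
by rewrite /= -!EFinD; congr EFin; ring.
Qed.

End SignedKernelLayers.

(** * Reconstruction of the history *)

Section LebesgueIsometries.
Context (R : realType).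

Lemma measurable_shift (b : R) :
  measurable_fun setT (fun x : measurableTypeR R => b + x : measurableTypeR R).
Proof. exact: measurable_funD. Qed.

Lemma lebesgue_measure_shift (b : R) (A : set R) : measurable A ->
  pushforward leb (fun x : measurableTypeR R => b + x : measurableTypeR R) A = leb A.
Proof.
move=> mA; apply/esym/lebesgue_measure_unique => //=; first exact: measurable_shift.
move=> _ _ [[u v]] _ <-.
rewrite /pushforward (_ : _ @^-1` _ = `]u - b, v - b]%classic); last first.
  by apply/seteqP; split=> x /=; rewrite !in_itv/= ltrBlDl lerBrDl.
by rewrite !lebesgue_measure_itv/= !lte_fin ltrD2r -!EFinB opprB addrA subrK.
Qed.

Lemma ge0_integral_shift (b : R) (f : R -> \bar R) : measurable_fun `]b, +oo[ f ->
    (forall x, b < x -> (0 <= f x)%E) ->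
  (\int[leb]_(x in Rpos) f (b + x)%R = \int[leb]_(x in `]b, +oo[) f x)%E.
Proof.
move=> mf f0.
rewrite (_ : Rpos = (fun x : measurableTypeR R => b + x : measurableTypeR R)
    @^-1` `]b, +oo[%classic); last first.
  apply/seteqP; split => x /=; rewrite RposE !in_itv/= !andbT ltrDl//.
rewrite -(@ge0_integral_pushforward _ _ _ _ _ _ (measurable_shift b) leb
  `]b, +oo[%classic f) //.
- apply: eq_measure_integral; first exact: measurable_shift.
  by move=> mm A mA _; exact: lebesgue_measure_shift.
- by move=> y; rewrite inE/= in_itv/= andbT => /f0.
Qed.

(** Applied with a jump point [b]: what holds for almost every [s] holds at [b - tau] for almost
    every [tau]. *)
Lemma ae_reflect (P : R -> Prop) (b : R) :
  {ae leb, forall s, P s} -> {ae leb, forall s, P (b - s)}.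
Proof.
move=> [N [mN N0 PN]].
exists ((-%R : R -> R) @^-1` ((fun x => b + x) @^-1` N)).
have mbN : measurable ((fun x : R => b + x) @^-1` N).
  by rewrite -[X in measurable X]setTI; apply: measurable_shift.
split.
- by rewrite -[X in measurable X]setTI; apply: oppr_measurable.
- transitivity (leb ((fun x : R => b + x) @^-1` N)).
    exact: lebesgue_measureN mbN.
  by rewrite -N0; exact: lebesgue_measure_shift.
- by move=> s /= nP; exact: PN.
Qed.

Lemma ae_integrable (D : set R) (f h : R -> R) : measurable D ->
    measurable_fun D f -> leb.-integrable D (EFin \o h) ->
    {ae leb, forall x, D x -> f x = h x} ->
  leb.-integrable D (EFin \o f) /\
  (\int[leb]_(x in D) (f x)%:E = \int[leb]_(x in D) (h x)%:E)%E.
Proof.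
move=> mD mf Ih fh; have mh := measurable_int _ Ih.
have mf' : measurable_fun D (EFin \o f) by exact/measurable_EFinP.
split; last first.
  apply: ae_eq_integral => //.
  by move: fh; apply: ae_mono => x hx Dx; rewrite /= hx.
apply/integrableP; split=> //.
rewrite (_ : (\int[leb]_(x in D) _)%E = (\int[leb]_(x in D) `|(h x)%:E|)%E).
  by have /integrableP[] := Ih.
apply: ae_eq_integral => //; [exact: measurableT_comp|exact: measurableT_comp|].
by move: fh; apply: ae_mono => x hx Dx; rewrite /= hx.
Qed.

End LebesgueIsometries.

(** * The image of the past integral under Lambda and the reconstruction error *)

Section Reconstruction.
Context (R : realType) (K : memory_kernel R) (X Y W : normedModType R).
Variables (iY : {linear Y -> W}) (A : X -> W).
Hypotheses (iY_inj : injective iY) (iY_cont : continuous iY).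
Variable Lambda : {linear M0 K Y -> S0 K Y}.
Hypotheses (Lambda_def : is_Lambda Lambda) (Lambda_id : Lambda_identity Lambda).

Lemma embedding_functional (phi : W -> R) : bounded_functional phi ->
  bounded_functional (phi \o iY).
Proof.
move=> hphi; split=> [x y|a x|].
- by rewrite /= linearD (functionalD hphi).
- by rewrite /= linearZ (functionalZ hphi).
- have [C C0 hC] := functional_lipschitz hphi.
  have /linear_boundedP/pinfty_ex_gt0[M M0 hM] :=
    (linear_bounded_continuous iY).2 iY_cont.
  by exists (C * M) => x; rewrite (le_trans (hC _))// -mulrA ler_wpM2l// ltW.
Qed.

Lemma normalized_functional (y : Y) : y != 0 -> exists (y0 : Y) (phi : Y -> R),
  bounded_functional phi /\ phi y0 = 1.
Proof.
move=> /separating_functional[phi [phiD phiZ hphi phiy]].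
exists ((phi y)^-1 *: y), phi; split; last by rewrite phiZ mulVf.
by split=> //; exists 1 => x; rewrite mul1r.
Qed.

Variables (x : R -> X) (t : R) (psi : M0 K Y).
Hypothesis psiE : mu_ae K (fun s => past_integral A x t s (iY (hfun psi s))).

(** Dividing [k] by the kernel recovers the scalar function [phi (A (x (t - s)))] on []0, t[] almost
    everywhere on the support of [K (tau + .)]. Its primitive there is [phi] of the past
    integral. *)
Lemma past_integral_scalar (tau : R) (phi : W -> R) (k : R -> R) :
    0 < tau -> bounded_functional phi ->
    leb.-integrable `]0, t[ (EFin \o k) ->
    {ae leb, forall s, (`]0, t[%classic : set R) s ->
      phi (K (tau + s) *: A (x (t - s))) = k s} ->
  let g := (fun s => k s / K (tau + s)) \_ (`]0, t[%classic : set R) in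
  [/\ measurable_fun setT g,
      leb.-integrable `]0, t[ (EFin \o (fun s => K (tau + s) * g s)),
      (\int[leb]_(s in `]0%R, t[) (K (tau + s) * g s)%:E =
        \int[leb]_(s in `]0%R, t[) (k s)%:E)%E &
      forall s, 0 < s -> (forall y, 0 < y < s -> K (tau + y) != 0) ->
        past_integral A x t s (iY (hfun psi s)) ->
        (leb.-integrable `]0, s[ (EFin \o g) /\
        (\int[leb]_(y in `]0%R, s[) (g y)%:E = (phi (iY (hfun psi s)))%:E)%E)].
Proof.
move=> tau0 hphi Ik kE g.
have mK : measurable_fun `]0, t[ (fun s => K (tau + s)).
  apply: measurable_funS (memory_kernel_shift_measurable K tau0).
    exact: measurable_Rpos.
  by move=> s /=; rewrite RposE in_itv/= => /andP[].
have mg0 : measurable_fun `]0, t[ (fun s => k s / K (tau + s)).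
  apply: measurable_funM; first by apply/measurable_EFinP; exact: measurable_int Ik.
  apply: (eq_measurable_fun (fun s => K (tau + s) `^ (-1))).
    move=> s; rewrite inE/= in_itv/= => /andP[s0 _].
    by rewrite powR_inv1// mu_ge0// addr_gt0.
  by apply: (@measurableT_comp _ _ _ _ _ _ (@powR R ^~ (-1))).
have mg : measurable_fun setT g by apply/(measurable_restrictT _ (measurable_itv _)).
have gE s : 0 < s < t -> g s = k s / K (tau + s).
  by move=> st; rewrite /g patchE ifT// inE/= in_itv.
have KgE : {ae leb, forall s, (`]0, t[%classic : set R) s -> K (tau + s) * g s = k s}.
  move: kE; apply: ae_mono => s hs st; have := hs st.
  move: st; rewrite /= in_itv/= => st; rewrite (functionalZ hphi) gE// => <-.
  by have [->|K0] := eqVneq (K (tau + s)) 0; rewrite ?mul0r// mulrC divfK.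
have [IKg KgI] : leb.-integrable `]0, t[ (EFin \o (fun s => K (tau + s) * g s)) /\
    (\int[leb]_(s in `]0%R, t[) (K (tau + s) * g s)%:E =
      \int[leb]_(s in `]0%R, t[) (k s)%:E)%E.
  apply: ae_integrable => //; apply: measurable_funM => //.
  exact: measurable_funTS.
split => // s s0 Ks /(bochner_functional hphi (measurable_itv _))[h [Ih hE hint]].
have sub y : 0 < y < Num.min t s -> 0 < y < t /\ 0 < y < s.
  by rewrite lt_min => /and3P[-> -> ->].
have [Ig gI] : leb.-integrable `]0, (Num.min t s)[ (EFin \o g) /\
    (\int[leb]_(y in `]0%R, (Num.min t s)[) (g y)%:E =
     \int[leb]_(y in `]0%R, (Num.min t s)[) (h y)%:E)%E.
  apply: ae_integrable => //; first exact: measurable_funTS.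
  move: (ae_and hE kE); apply: ae_mono => y [hy ky] yI.
  have [yt ys] : 0 < y < t /\ 0 < y < s by apply: sub; move: yI; rewrite /= in_itv.
  rewrite -hy// gE// -ky ?(functionalZ hphi); last by rewrite /= in_itv.
  by rewrite mulrAC mulfV ?mul1r// Ks.
(* As [g] vanishes from [t] on, integrating up to [s] or up to [Num.min t s] is the same; the latter
   is the range of [past_integral]. *)
have gs : (EFin \o g) \_ `]0, s[ = (EFin \o g) \_ `]0, (Num.min t s)[.
  apply/funext => y; rewrite !patchE !mem_setE !in_itv/= lt_min.
  have [yt|yt] := boolP (0 < y < t); last first.
    rewrite /g patchE mem_setE in_itv/= (negPf yt) if_same.
    by case: ifP.
  by case/andP: yt => -> ->.
split.
  apply: (integrable_mkcond _ _).2 => //; rewrite gs.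
  by apply: (integrable_mkcond _ _).1.
rewrite -hint -gI.
transitivity (\int[leb]_y ((EFin \o g) \_ `]0%R, s[) y)%E; first exact: integral_mkcond.
by rewrite gs; apply/esym; exact: integral_mkcond.
Qed.

(** If the two sides differed, a functional [phi] of [W] would separate them, whereas integration by
    parts with [G s = phi (iY (hfun psi s))] gives them the same image. The nonzero [y] yields the
    functional on [Y] behind the scalar kernel identity. *)
Lemma Lambda_past_integral (y : Y) (tau : R) (J : Y) (I : W) : y != 0 -> 0 < tau ->
    Lambda_formula K (hfun psi) tau J ->
    (forall k, is_jump K k -> tau < jump_at K k ->
       past_integral A x t (jump_at K k - tau) (iY (hfun psi (jump_at K k - tau)))) ->
    bochner_integral `]0, t[ (fun s => K (tau + s) *: A (x (t - s))) I ->
  iY J = I.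
Proof.
move=> y_neq0 tau0 [I1 [I2 [hI1 hI2 JE]]] hJ hI.
have [y0 [phi0 [hphi0 phi01]]] := normalized_functional y_neq0.
apply/eqP; rewrite -subr_eq0; apply: contrapT => /negP.
move=> /separating_functional[phi [phiD phiZ hphi1 /negP]]; apply.
have hphi : bounded_functional phi by split=> //; exists 1 => v; rewrite mul1r.
have hPhi := embedding_functional hphi.
have [k [Ik kE kI]] := bochner_functional hphi (measurable_itv _) hI.
have [h [Ih hE hint]] := bochner_functional hPhi (@measurable_Rpos R) hI1.
have [] := past_integral_scalar tau0 hphi Ik kE; set g := _ \_ _.
move=> mg IKg KgI gG.
have gt s : ~ (0 < s < t) -> g s = 0.
  by move=> st; rewrite /g patchE mem_setE in_itv/=; case: ifP.
rewrite (functionalB hphi) subr_eq0; apply/eqP/esym/EFin_inj.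
rewrite -kI -KgI (@kernel_integral_by_parts _ _ _ tau0 _ _ _ hphi0 phi01 _ Lambda_id
  t g (fun s => phi (iY (hfun psi s))) h (phi (iY I2))) //.
- rewrite hint JE -EFinB linearD linearN (functionalD hphi) (functionalN hphi).
  by rewrite addrC.
- move: psiE; apply: ae_mono => s hs s0 Ks; apply: gG => //.
    move=> z /andP[z0 zs]; apply: contra Ks => /eqP Kz; apply/eqP.
    apply: memory_kernel_vanishes Kz; first by rewrite addr_gt0.
    by rewrite lerD2l ltW.
  apply: hs => //; apply: contra Ks => /eqP Kz; apply/eqP.
  by apply: memory_kernel_vanishes Kz => //; rewrite lerDr ltW.
- move=> j jj tauj; apply: gG; [by rewrite subr_gt0| |exact: hJ].
  move=> z /andP[z0 zj]; apply: (memory_kernel_jump_neq0 jj); first by rewrite addr_gt0.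
  by rewrite -ltrBrDl.
- move: hE; apply: ae_mono => s hs s0.
  by rewrite -hs ?RposE//= linearZ/= (functionalZ hphi).
- rewrite (_ : (fun N => _) = (phi \o iY) \o (fun N =>
      \sum_(0 <= n < N | is_jump K n && (tau < jump_at K n))
        jump_size K n *: hfun psi (jump_at K n - tau))).
    exact: functional_cvg hI2.
  apply/funext => N /=; apply/esym; rewrite linear_sum/=.
  elim/big_ind2: _ => [|u1 u2 v1 v2 <- <-|n _].
  + by rewrite (functional0 hphi).
  + by rewrite (functionalD hphi).
  + by rewrite linearZ/= (functionalZ hphi).
Qed.

(** The jump terms evaluate [psi] at single points. There are countably many jumps, so almost every
    [tau] keeps all points [jump_at K k - tau] out of the exceptional set of [psiE]. *)
Lemma Lambda_past_integral_ae (y : Y) : y != 0 -> {ae leb, forall tau, 0 < tau ->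
  forall I : W, bochner_integral `]0, t[ (fun s => K (tau + s) *: A (x (t - s))) I ->
  iY (Defs.sfun (Lambda psi) tau) = I}.
Proof.
move=> y_neq0.
have jumps : {ae leb, forall tau, forall k, 0 < jump_at K k - tau ->
    K (jump_at K k - tau) != 0 ->
    past_integral A x t (jump_at K k - tau) (iY (hfun psi (jump_at K k - tau)))}.
  by apply: ae_foralln => k; exact: (ae_reflect (jump_at K k) psiE).
move: (ae_and (Lambda_def psi) jumps); apply: ae_mono => tau [hL hJ] tau0 I.
apply: (Lambda_past_integral y_neq0 tau0 (hL tau0)) => k jk tauk.
apply: hJ; first by rewrite subr_gt0.
by apply: (memory_kernel_jump_neq0 jk); rewrite ?subr_gt0// ltrBlDr ltrDl.
Qed.

Lemma nu_decay (Theta delta tau : R) : 1 <= Theta -> 0 <= t -> 0 < tau ->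
    (forall a b, 0 < a -> 0 < b -> K (a + b) <= Theta * expR (- delta * a) * K b) ->
    K (t + tau) != 0 ->
  nu K tau <= Theta * expR (- delta * t) * nu K (t + tau).
Proof.
move=> Theta1 t0 tau0 decay Kt.
have pos u : 0 < u -> K u != 0 -> 0 < K u by move=> u0 Ku; rewrite lt0r Ku mu_ge0.
have Ktau : K tau != 0.
  apply: contra Kt => /eqP Kz; apply/eqP.
  by apply: memory_kernel_vanishes Kz => //; rewrite lerDr.
rewrite /nu (negPf Kt) (negPf Ktau) ler_pdivlMr; last by rewrite pos// ltr_wpDl.
rewrite mulrC ler_pdivrMr ?pos//.
(* The decay of the kernel is stated for positive shifts; at [t = 0] the estimate reduces to
   [1 <= Theta]. *)
move: t0; rewrite le_eqVlt => /predU1P[<-|t0]; last exact: decay.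
by rewrite mulr0 expR0 mulr1 add0r ler_peMl// mu_ge0.
Qed.

(** The integral term of [xi] is cancelled by [Lambda psi], which leaves the left translate of
    [xi0]. The decay of [nu] and a change of variables bound its norm. *)
Lemma reconstruction_error (Theta delta : R) (xi xi0 : S0 K Y) :
    1 <= Theta -> 0 <= t ->
    (forall a b, 0 < a -> 0 < b -> K (a + b) <= Theta * expR (- delta * a) * K b) ->
    {ae leb, forall tau, 0 < tau -> exists2 I : W,
      bochner_integral `]0, t[ (fun s => K (tau + s) *: A (x (t - s))) I &
      iY (Defs.sfun xi tau) = iY (Defs.sfun xi0 (t + tau)) + I} ->
  `|xi - Lambda psi| ^+ 2 <= Theta * expR (- delta * t) * `|xi0| ^+ 2.
Proof.
move=> Theta1 t0 decay hxi.
have diffE : {ae leb, forall tau, 0 < tau ->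
    Defs.sfun xi tau - Defs.sfun (Lambda psi) tau = Defs.sfun xi0 (t + tau)}.
  (* The scalar identity requires a nonzero vector of [Y]; in the trivial space all values
     coincide. *)
  have [[y y0]|triv] := pselect (exists y : Y, y != 0).
    move: (ae_and hxi (Lambda_past_integral_ae y0)).
    apply: ae_mono => tau [h1 h2] tau0; apply: iY_inj.
    have [I hI E] := h1 tau0.
    by rewrite linearB E (h2 tau0 I hI) addrK.
  have all0 (u v : Y) : u = v.
    suff z (w : Y) : w = 0 by rewrite (z u) (z v).
    by apply/eqP/negPn/negP => w0; apply: triv; exists w.
  by apply: aeW => tau _; exact: all0.
pose C := Theta * expR (- delta * t).
have C0 : 0 <= C by rewrite mulr_ge0 ?expR_ge0// (le_trans ler01).
pose F (tau : R) : \bar R := (nu_weight K tau * `|Defs.sfun xi0 tau| ^+ 2)%:E.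
have mF : measurable_fun Rpos F by exact: L2_repr_measurable.
have F0 tau : 0 < tau -> (0 <= F tau)%E.
  by move=> tau0; rewrite lee_fin mulr_ge0 ?sqr_ge0// nu_ge0.
have sub : (`]t, +oo[%classic : set R) `<=` Rpos.
  by move=> s /=; rewrite RposE in_itv/= andbT; exact: le_lt_trans.
have mFt : measurable_fun Rpos (fun tau => F (t + tau)).
  apply: (@measurable_comp _ _ _ _ _ _ Rpos).
  - exact: measurable_Rpos.
  - by move=> _ [s + <-]; rewrite !RposE => s0; rewrite ltr_wpDl.
  - exact: mF.
  - exact: measurable_funD.
have [mD DE] := @norm_L2B _ (nu_weight K) Y xi (Lambda psi).
rewrite -lee_fin DE.
apply: (@le_trans _ _ (\int[leb]_(tau in Rpos) (C%:E * F (t + tau)%R))%E).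
  apply: ae_ge0_le_integral => //.
  - by move=> s; rewrite RposE => s0; rewrite lee_fin mulr_ge0 ?sqr_ge0// nu_ge0.
  - move=> s; rewrite RposE => s0.
    by apply: mule_ge0; [rewrite lee_fin|apply: F0; rewrite ltr_wpDl].
  - exact: measurable_funeM.
  - move: diffE; apply: ae_mono => tau hd; rewrite RposE => tau0.
    rewrite [X in `|X|](hd tau0) /F -EFinM lee_fin.
    (* The estimate on [nu] fails where the kernel vanishes, but there the chosen representative of
       [xi0] is 0. *)
    have [Kt|Kt] := eqVneq (K (t + tau)) 0.
      rewrite (_ : Defs.sfun xi0 (t + tau) = 0).
        by rewrite normr0 expr0n/= !mulr0.
      by rewrite /Defs.sfun /L2_repr /= /nu Kt eqxx ifT.
    by rewrite [leRHS]mulrA; apply: ler_wpM2r; [exact: sqr_ge0|exact: nu_decay].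
rewrite ge0_integralZl ?lee_fin//; last first.
  by move=> s; rewrite RposE => s0; rewrite F0// ltr_wpDl.
rewrite -/C [leRHS]EFinM; apply: lee_wpmul2l; first by rewrite lee_fin.
rewrite (@sqr_norm_L2 _ (nu_weight K) Y xi0).
rewrite ge0_integral_shift; last 2 first.
- exact: (measurable_funS (@measurable_Rpos R) sub mF).
- by move=> s ts; rewrite F0// (le_lt_trans t0).
apply: ge0_subset_integral => //.
by move=> s; rewrite RposE => /F0.
Qed.

End Reconstruction.

Theorem theorem6p3 (R : realType) (K : memory_kernel R)
  (X0 X1 Y0 Y1 : completeNormedModType R)
  (X0_refl : reflexive_space X0) (X1_refl : reflexive_space X1)
  (Y0_refl : reflexive_space Y0) (Y1_refl : reflexive_space Y1)
  (eX : {linear X1 -> X0}) (eX_emb : dense_compact_embedding eX)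
  (eY : {linear Y1 -> Y0}) (eY_emb : dense_compact_embedding eY)
  (W : completeNormedModType R)
  (iX : {linear X0 -> W}) (iX_inj : injective iX) (iX_cont : continuous iX)
  (iY : {linear Y0 -> W}) (iY_inj : injective iY) (iY_cont : continuous iY)
  (DA DB : set X0) (A B : X0 -> W) (DA_dense : dense DA) (DB_dense : dense DB)
  (S : R -> H0 K X0 Y0 -> H0 K X0 Y0)
  (Shat : R -> V0 K X0 Y0 -> V0 K X0 Y0)
  (adm : (R -> H0 K X0 Y0) -> Prop) (admhat : (R -> V0 K X0 Y0) -> Prop)
  (S_sol : solution_semigroup adm
     (fun z => history_solution iX iY DA DB A B z) S)
  (Shat_sol : solution_semigroup admhat
     (fun z => state_solution iX iY DA DB A B z) Shat)
  (QS kappa : R -> R) (QS_I : nondecreasing_nonneg QS)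
  (kappa01 : forall r, 0 <= r -> 0 < kappa r <= 1)
  (S_hoelder : hoelder_semigroup QS kappa S)
  (Shat_hoelder : hoelder_semigroup QS kappa Shat)
  (Lambda : {linear M0 K Y0 -> S0 K Y0}) (Lambda_def : is_Lambda Lambda)
  (Lambda_norm : unit_norm (fun z : H0 K X0 Y0 => LambdaX Lambda z))
  (Lambda_id : Lambda_identity Lambda)
  (Lambda_intertwines : forall (t : R) (z : H0 K X0 Y0), 0 <= t ->
     Shat t (LambdaX Lambda z) = LambdaX Lambda (S t z))
  (reconstruction : exists Q : R -> R, nondecreasing_nonneg Q /\
     reconstruction_bound iY A Shat Q)
  (E : set (H0 K X0 Y0)) (E_attr : exponential_attractor S E) :
  exponential_attractor Shat
    ((fun z : H0 K X0 Y0 => LambdaX Lambda z) @` E).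
Proof.
have [Q [ [Q0 _] recQ]] := reconstruction.
have [ Theta [delta [ Theta1 delta0 decay]]] := mu_decay K.
have [Shat_semigroup Shat_state] := Shat_sol.
have LB z z' : LambdaX Lambda z - LambdaX Lambda z' = LambdaX Lambda (z - z').
  have -> : LambdaX Lambda (z - z') =
      vpair (hPi1 z - hPi1 z') (Lambda (hPi2 z - hPi2 z')) by [].
  by rewrite linearB.
have Theta0 : 0 <= Theta by rewrite (le_trans ler01).
(* The square root of [Theta] and the halved rate arise because the reconstruction error is
   estimated in squared norm. *)
apply: (@exponential_attractor_transfer _ _ _ _ _ S Shat Shat_semigroup _
  Lambda_intertwines QS kappa QS_I.1 kappa01 Shat_hoelder
  (Num.sqrt Theta) (delta / 2) Q) => //.
- by move=> z z'; rewrite LB Lambda_norm.1.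
- exact: Lambda_norm.1.
- by rewrite divr_gt0.
move=> r t z r0 t0 zr.
have [psi psiE psi_bound] := recQ r z r0 zr t t0.
exists (hpair (vPi1 (Shat t z)) psi) => //.
have [_ [_ state] _] := Shat_state z.
have := reconstruction_error iY_inj iY_cont Lambda_def Lambda_id psiE Theta1 t0
  decay (state t t0).
rewrite Shat_semigroup.1 => err.
(* The reconstructed state has the same first component as the trajectory, so only the memory
   component contributes. *)
rewrite norm_eprodE /= subrr normr0 expr0n add0r sqrtr_sqr normr_id.
rewrite -(@ler_sqr _ (`|_|)) ?nnegrE ?mulr_ge0 ?expR_ge0//.
apply: le_trans err _.
have expE : expR (- (delta / 2) * t) ^+ 2 = expR (- delta * t).
  by rewrite expr2 -expRD; congr expR; field.
have -> : (Num.sqrt Theta * expR (- (delta / 2) * t) * r) ^+ 2 =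
    Theta * expR (- delta * t) * r ^+ 2.
  by rewrite !exprMn sqr_sqrtr// expE.
apply: ler_wpM2l; first by rewrite mulr_ge0// expR_ge0.
rewrite ler_sqr ?nnegrE//; apply: le_trans zr.
rewrite norm_eprodE -[leLHS]normr_id -sqrtr_sqr ler_wsqrtr//.
by rewrite lerDr sqr_ge0.
Qed.
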